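(* Let $M$ be a 4-dimensional connected, orientable smooth manifold, $a$ a Lorentzian metric on $M$ of signature $(+,-,-,-)$ and $b$ a 1-form on $M$; put $A=a_{ij}\dot x^i\dot x^j$, $B=b_i\dot x^i$. The Randers-type deformation $$L=\epsilon\left(\sqrt{A}+B\right)^2,\qquad \epsilon=\mathrm{sign}(\sqrt{A}+B),$$ of $a$ defines a Finsler spacetime structure if and only if $$0\le\langle b,b\rangle<1 .$$ If this is the case, then each of its future-pointing timelike cones $\mathcal{T}_x$ is the intersection of the cone $A-B^2>0$ with the future-pointing timelike cone of $a$ at $x$.
   Context: $\overset{\circ}{TM}=TM\setminus\{0\}$ is the tangent bundle without its zero section, with local coordinates $(x^i,\dot x^i)$. A conic subbundle of $TM$ is a non-empty open submanifold $\mathcal{Q}\subset\overset{\circ}{TM}$ projecting onto all of $M$ and closed under $(x,\dot x)\mapsto(x,\lambda\dot x)$, $\lambda>0$. A pseudo-Finsler structure is a smooth function $L:\mathcal{A}\to\mathbb{R}$ on a conic subbundle $\mathcal{A}$ with $L(x,\lambda\dot x)=\lambda^2L(x,\dot x)$ for $\lambda>0$ and $g_{ij}=\frac12\frac{\partial^2L}{\partial\dot x^i\partial\dot x^j}$ nondegenerate on $\mathcal{A}$; $\mathcal{A}$ is typically understood as the maximal subset of $\overset{\circ}{TM}$ with these properties. Here $\langle b,b\rangle=a^{ij}b_ib_j$, where $(a^{ij})$ is the inverse of $(a_{ij})$; the condition on $\langle b,b\rangle$ is understood at every $x\in M$. $L$ defines a Finsler spacetime structure if it is a pseudo-Finsler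 structure and there exists a connected conic subbundle $\mathcal{T}\subset\mathcal{A}$ with connected fibers $\mathcal{T}_x=\mathcal{T}\cap T_xM$ such that on each $\mathcal{T}_x$: $L>0$, $g$ has signature $(+,-,-,-)$, and $L$ can be continuously extended as $0$ to the boundary $\partial\mathcal{T}_x$. The $\mathcal{T}_x$ are the future-pointing timelike cones of $L$. Standing assumption: at each $x\in M$, the cone $\mathcal{T}_x$ of $L$ and the future-pointing timelike cone $\mathcal{T}^a_x$ of $a$ (the connected component of $\{\dot x\in T_xM: A>0\}$ designated as future-pointing) have non-empty intersection. *)

(* Defs.v *)
From HB Require Import structures.
From mathcomp Require Import all_boot all_order all_algebra.
From mathcomp Require Import all_classical all_reals all_analysis.

Set Implicit Arguments.
Unset Strict Implicit.
Unset Printing Implicit Defensive.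

Import Order.TTheory GRing.Theory Num.Theory.
Import numFieldNormedType.Exports.

Local Open Scope classical_set_scope.
Local Open Scope ring_scope.

(* [C_on k U f]: f is of class C^k on the open set U (only the values of f on
   U matter).  Phrased with total and directional derivatives, which for a
   finite-dimensional domain V is the usual notion. *)
Fixpoint C_on (R : realType) (V W : normedModType R) (k : nat) (U : set V)
    (f : V -> W) : Prop :=
  match k with
  | 0 => forall x, U x -> {for x, continuous f}
  | k'.+1 => (forall x, U x -> differentiable f x) /\
             (forall v, C_on k' U (fun x => 'D_v f x))
  end.

Definition smooth_on (R : realType) (V W : normedModType R) (U : set V)
    (f : V -> W) : Prop :=
  forall k, C_on k U f.

Section Manifold.
Variable R : realType.

(* [chart_inv] is a total function, meaningful on [chart_cod] only. *)
Record chart (X : topologicalType) := Chart {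
  chart_dom : set X;
  chart_map :> X -> 'rV[R]_4;
  chart_inv : 'rV[R]_4 -> X;
  chart_cod := chart_map @` chart_dom;
  chart_dom_open : open chart_dom;
  chart_cod_open : open chart_cod;
  chart_mapK : forall x, chart_dom x -> chart_inv (chart_map x) = x;
  chart_map_continuous : {within chart_dom, continuous chart_map};
  chart_inv_continuous : {within chart_cod, continuous chart_inv}
}.

Definition transition (X : topologicalType) (c d : chart X)
    (xi : 'rV[R]_4) : 'rV[R]_4 := d (chart_inv c xi).

Definition smooth_transition (X : topologicalType) (c d : chart X) : Prop :=
  smooth_on [set xi | chart_cod c xi /\ chart_dom d (chart_inv c xi)]
            (transition c d).

(* A chart around each point is selected; it serves only to coordinatize the
   tangent space at that point. *)
Record manifold := Manifold {
  space :> topologicalType;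
  atlas : set (chart space);
  chart_at : space -> chart space;
  space_hausdorff : hausdorff_space space;
  space_second_countable : @second_countable space;
  chart_at_atlas : forall x, atlas (chart_at x);
  chart_at_dom : forall x, chart_dom (chart_at x) x;
  atlas_smooth : forall c d, atlas c -> atlas d -> smooth_transition c d
}.

Definition orientable (M : manifold) : Prop :=
  exists B : set (chart M),
    [/\ forall x : M, exists2 c, B c & chart_dom c x,
        forall c d, B c -> atlas d ->
          smooth_transition c d /\ smooth_transition d c &
        forall c d, B c -> B d -> forall x : M, chart_dom c x ->
          chart_dom d x -> 0 < \det (jacobian (transition c d) (c x))].

(* [Tangent x v] is the vector at x whose components in the chart
   [chart_at x] are v; so each tangent space is identified with 'rV[R]_4. *)
Record tangent (M : manifold) := Tangent {
  base : M;
  vec : 'rV[R]_4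
}.

HB.instance Definition _ (M : manifold) := gen_eqMixin (tangent M).
HB.instance Definition _ (M : manifold) := gen_choiceMixin (tangent M).

(* The i-th row is the coordinate vector of index i of the chart c, at the
   point of coordinates xi, written in the preferred chart of that point. *)
Definition frame (M : manifold) (c : chart M) (xi : 'rV[R]_4) : 'M[R]_4 :=
  jacobian (transition c (chart_at (chart_inv c xi))) xi.

(* The tangent vector with coordinates (x^i, xdot^i) = z in the chart c. *)
Definition tangent_of (M : manifold) (c : chart M)
    (z : 'rV[R]_4 * 'rV[R]_4) : tangent M :=
  Tangent (chart_inv c z.1) (z.2 *m frame c z.1).

Definition tangent_coords (M : manifold) (c : chart M) (Q : set (tangent M)) :
    set ('rV[R]_4 * 'rV[R]_4) :=
  [set z | chart_cod c z.1 /\ Q (tangent_of c z)].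

Definition tangent_open (M : manifold) : set_system (tangent M) :=
  [set Q | forall c, atlas c -> open (tangent_coords c Q)].

Lemma tangent_openT (M : manifold) : @tangent_open M setT.
Proof.
move=> c _; rewrite (_ : tangent_coords c setT = fst @^-1` chart_cod c).
  by apply: open_comp; [move=> z _; exact: cvg_fst | exact: chart_cod_open].
by apply/seteqP; split=> z //= -[].
Qed.

Lemma tangent_openI (M : manifold) : setI_closed (@tangent_open M).
Proof.
move=> P Q oP oQ c ac.
rewrite (_ : tangent_coords c _ = tangent_coords c P `&` tangent_coords c Q).
  by apply: openI; [exact: oP | exact: oQ].
by apply/seteqP; split=> z /= => [[? []]|[[? ?] [? ?]]].
Qed.

Lemma tangent_open_bigcup (M : manifold) (I : Type) (f : I -> set (tangent M)) :
  (forall i, tangent_open (f i)) -> tangent_open (\bigcup_i f i).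
Proof.
move=> of_ c ac.
rewrite (_ : tangent_coords c _ = \bigcup_i tangent_coords c (f i)).
  by apply: bigcup_open => i _; exact: of_.
apply/seteqP; split=> z /= => [[cz [i _ fz]]|[i _ [cz fz]]].
  by exists i.
by split=> //; exists i.
Qed.

HB.instance Definition _ (M : manifold) :=
  isOpenTopological.Build (tangent M) (@tangent_openT M) (@tangent_openI M)
    (@tangent_open_bigcup M).

Definition fiber (M : manifold) (Q : set (tangent M)) (x : M) :
    set 'rV[R]_4 :=
  [set v | Q (Tangent x v)].

Definition smooth_tangent (M : manifold) (Q : set (tangent M))
    (L : tangent M -> R) : Prop :=
  forall c, atlas c ->
    smooth_on (tangent_coords c Q) (fun z => L (tangent_of c z) : R^o).

Definition conic_subbundle (M : manifold) (Q : set (tangent M)) : Prop :=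
  [/\ Q !=set0,
      open Q,
      forall p, Q p -> vec p != 0,
      forall x : M, fiber Q x !=set0 &
      forall x v (t : R), 0 < t -> Q (Tangent x v) -> Q (Tangent x (t *: v))].

Definition vertical_hessian (M : manifold) (L : tangent M -> R)
    (p : tangent M) : 'M[R]_4 :=
  \matrix_(i, j) (2^-1 *
    'D_(delta_mx 0 i) (fun w => 'D_(delta_mx 0 j)
       (fun v => L (Tangent (base p) v) : R^o) w) (vec p)).

(* [D] is the set where the expression L is defined. *)
Definition pseudo_finsler (M : manifold) (D : set (tangent M))
    (L : tangent M -> R) (Q : set (tangent M)) : Prop :=
  [/\ conic_subbundle Q,
      Q `<=` D,
      smooth_tangent Q L,
      forall x v (t : R), 0 < t -> Q (Tangent x v) ->
        L (Tangent x (t *: v)) = t ^+ 2 * L (Tangent x v) &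
      forall p, Q p -> vertical_hessian L p \in unitmx].

(* Signature (+,-,-,-). *)
Definition lorentz_signature (G : 'M[R]_4) : Prop :=
  exists2 P : 'M[R]_4, P \in unitmx &
    P *m G *m P^T = diag_mx (\row_(j < 4) if j == 0 then 1 else -1).

(* The last clause: on the closure of the open cone C, the function equal to L
   on C and to 0 on the boundary is continuous. *)
Definition timelike_fiber (M : manifold) (L : tangent M -> R) (x : M)
    (C : set 'rV[R]_4) : Prop :=
  [/\ connected C,
      forall v, C v -> 0 < L (Tangent x v),
      forall v, C v -> lorentz_signature (vertical_hessian L (Tangent x v)) &
      {within closure C, continuous ((fun v => L (Tangent x v)) \_ C)}].

Definition finsler_cones (M : manifold) (D : set (tangent M))
    (L : tangent M -> R) (T : set (tangent M)) : Prop :=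
  [/\ conic_subbundle T,
      connected T,
      exists2 Q, pseudo_finsler D L Q & T `<=` Q &
      forall x, timelike_fiber L x (fiber T x)].

Definition finsler_spacetime (M : manifold) (D : set (tangent M))
    (L : tangent M -> R) : Prop :=
  exists T, finsler_cones D L T.

(* The same requirements on a cone in a single tangent space. *)
Definition timelike_cone_at (M : manifold) (D : set (tangent M))
    (L : tangent M -> R) (x : M) (C : set 'rV[R]_4) : Prop :=
  [/\ C !=set0,
      open C,
      forall v (t : R), 0 < t -> C v -> C (t *: v),
      exists2 Q, pseudo_finsler D L Q & C `<=` fiber Q x &
      timelike_fiber L x C].

(* A tensor field is given at x by its components in the chart [chart_at x];
   the products with [frame c xi] are its components in the chart c. *)
Definition lorentzian_metric (M : manifold) (a : M -> 'M[R]_4) : Prop :=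
  (forall x, lorentz_signature (a x)) /\
  (forall c, atlas c -> forall i j,
     smooth_on (chart_cod c) (fun xi =>
       (frame c xi *m a (chart_inv c xi) *m (frame c xi)^T) i j : R^o)).

Definition one_form (M : manifold) (b : M -> 'rV[R]_4) : Prop :=
  forall c, atlas c -> forall i,
    smooth_on (chart_cod c) (fun xi =>
      (b (chart_inv c xi) *m (frame c xi)^T) 0 i : R^o).

Definition quad (M : manifold) (a : M -> 'M[R]_4) (p : tangent M) : R :=
  (vec p *m a (base p) *m (vec p)^T) 0 0.

Definition pairing (M : manifold) (b : M -> 'rV[R]_4) (p : tangent M) : R :=
  (b (base p) *m (vec p)^T) 0 0.

Definition dual_norm (M : manifold) (a : M -> 'M[R]_4) (b : M -> 'rV[R]_4)
    (x : M) : R :=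
  (b x *m invmx (a x) *m (b x)^T) 0 0.

Definition randers (M : manifold) (a : M -> 'M[R]_4) (b : M -> 'rV[R]_4)
    (p : tangent M) : R :=
  let s := Num.sqrt (quad a p) + pairing b p in Num.sg s * s ^+ 2.

(* Where the real square root of A makes sense. *)
Definition randers_dom (M : manifold) (a : M -> 'M[R]_4) : set (tangent M) :=
  [set p | 0 <= quad a p].

(* A continuous choice, at every x, of a connected component of {A > 0} as the
   future-pointing timelike cone of a. *)
Definition time_orientation (M : manifold) (a : M -> 'M[R]_4)
    (Ta : set (tangent M)) : Prop :=
  open Ta /\
  forall x, exists2 v, 0 < quad a (Tangent x v) &
    fiber Ta x = connected_component [set w | 0 < quad a (Tangent x w)] v.

(* At each x, if L has timelike cones at all, one of them meets the
   future-pointing timelike cone of a. *)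
Definition cones_meet (M : manifold) (D : set (tangent M))
    (L : tangent M -> R) (Ta : set (tangent M)) : Prop :=
  forall x, (exists C, timelike_cone_at D L x C) ->
    exists2 C, timelike_cone_at D L x C & C `&` fiber Ta x !=set0.

End Manifold.

(* Main.v *)
Require Import Defs.
From HB Require Import structures.
From mathcomp Require Import all_boot all_order all_algebra.
From mathcomp Require Import all_classical all_reals all_analysis.
From mathcomp Require Import ring lra.
Import Order.TTheory GRing.Theory Num.Theory.
Import numFieldNormedType.Exports.
Set Implicit Arguments.
Unset Strict Implicit.
Unset Printing Implicit Defensive.
Local Open Scope classical_set_scope.
Local Open Scope ring_scope.

(* Write F = sqrt A and K for a component of {A > 0} at a point.  By the reverse
   Cauchy-Schwarz inequality F is concave on K, so {F + B > 0} meets K in a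
   convex set.  A timelike cone C of L meeting K lies in this set and is
   relatively closed in it, because L vanishes at the boundary points of C;
   hence C is the intersection of K with {F + B > 0}.  If B were positive
   somewhere on K, C would have a null boundary vector with F + B = B > 0.  So
   B <= 0 on K, which makes b causal and C the intersection of K with
   {A > B^2}; this set is nonempty only if <b,b> < 1.
   Conversely, a causal b has constant sign on K, so B <= 0 on K or on -K, and
   the intersection of that cone with {A > B^2} is a timelike cone.  The
   standing assumption rules out B > 0 on the future cone.  With s = F + B, the
   Hessian of L/2 at v is ds (x) ds + (s/F) (a - (a v) (x) (a v) / A), which is
   diagonalized by adapting an orthonormal frame to v. *)

(** * Lorentzian quadratic forms *)

Definition form (R : realType) (a : 'M[R]_4) (u v : 'rV[R]_4) : R :=
  (u *m a *m v^T) 0 0.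

Section Form.
Variables (R : realType) (a : 'M[R]_4).
Implicit Types u v w : 'rV[R]_4.

Lemma formDl u v w : form a (u + v) w = form a u w + form a v w.
Proof. by rewrite /form !mulmxDl mxE. Qed.

Lemma formDr u v w : form a w (u + v) = form a w u + form a w v.
Proof. by rewrite /form linearD /= mulmxDr mxE. Qed.

Lemma formZl t u w : form a (t *: u) w = t * form a u w.
Proof. by rewrite /form -!scalemxAl mxE. Qed.

Lemma formZr t u w : form a w (t *: u) = t * form a w u.
Proof. by rewrite /form linearZ /= -!scalemxAr mxE. Qed.

Lemma formNl u w : form a (- u) w = - form a u w.
Proof. by rewrite -scaleN1r formZl mulN1r. Qed.

Lemma formNr u w : form a w (- u) = - form a w u.
Proof. by rewrite -scaleN1r formZr mulN1r. Qed.

Lemma form0l w : form a 0 w = 0.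
Proof. by rewrite -(scale0r 0) formZl mul0r. Qed.

Definition form_lin := (formDl, formDr, formNl, formNr, formZl, formZr).

Lemma form_neq0 v : 0 < form a v v -> v != 0.
Proof. by apply: contraTneq => ->; rewrite form0l ltxx. Qed.

Lemma form_delta v i : form a v (delta_mx 0 i) = (v *m a) 0 i.
Proof.
rewrite /form mxE (bigD1 i) //= big1 ?addr0 => [|j ji].
  by rewrite !mxE !eqxx mulr1.
by rewrite !mxE eqxx (negbTE ji) mulr0.
Qed.

Lemma form_row (P : 'M[R]_4) i j :
  form a (row i P) (row j P) = (P *m a *m P^T) i j.
Proof.
by rewrite /form -row_mul !mxE; apply: eq_bigr => k _; rewrite !mxE.
Qed.

End Form.

Section Lorentz.
Variables (R : realType) (a : 'M[R]_4) (a_lorentz : lorentz_signature a).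
Implicit Types (k n u v w : 'rV[R]_4) (t : R).
Local Notation eta :=
  (diag_mx (\row_(j < 4) if j == 0 then 1 else -1) : 'M[R]_4).

Lemma lorentz_trmx : a^T = a.
Proof.
(* Congruence to a symmetric, here diagonal, matrix forces [a] itself to be symmetric. *)
have [P uP PaP] := a_lorentz.
have /(congr1 (fun X => invmx P *m X *m invmx P^T)) := PaP.
rewrite !mulmxA mulVmx // mul1mx -mulmxA mulmxV ?unitmx_tr // mulmx1 => ->.
by rewrite -trmx_inv !trmx_mul trmxK tr_diag_mx mulmxA.
Qed.

Lemma lorentz_unitmx : a \in unitmx.
Proof.
have [P uP PaP] := a_lorentz.
have : P *m a *m P^T \in unitmx.
  rewrite PaP unitmxE det_diag unitfE; apply/prodf_neq0 => i _.
  by rewrite mxE; case: ifP; rewrite ?oppr_eq0 oner_neq0.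
by rewrite !unitmx_mul uP unitmx_tr uP andbT.
Qed.

Lemma form_sym u v : form a u v = form a v u.
Proof.
rewrite /form (_ : u *m a *m v^T = (v *m a *m u^T)^T) ?mxE //.
by rewrite !trmx_mul trmxK lorentz_trmx mulmxA.
Qed.

(* If the first vector of an orthonormal frame is [p] and [u] is a unit
   timelike vector, then [u - p] or [u + p] is not null, and reflecting the
   frame along it sends [p] to [u] or [- u]. *)
Lemma adapted_frame v : 0 < form a v v ->
  exists P : 'M[R]_4, [/\ P \in unitmx, P *m a *m P^T = eta &
    exists2 c : R, c ^+ 2 * form a v v = 1 & row 0 P = c *: v].
Proof.
have [P0 uP PaP] := a_lorentz; set p := row 0 P0.
have gpp : form a p p = 1.
  by rewrite form_row PaP !mxE /= mulr1n.
move=> v0; set c := (Num.sqrt (form a v v))^-1.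
have c2 : c ^+ 2 * form a v v = 1.
  by rewrite exprVn sqr_sqrtr ?(ltW v0) // mulVf // gt_eqF.
have reflected u : form a u u = 1 -> form a (p - u) (p - u) != 0 ->
    exists P : 'M[R]_4, [/\ P \in unitmx, P *m a *m P^T = eta & row 0 P = u].
  move=> guu; set n := p - u; set N := form a n n => N0.
  (* Acting on rows from the right, [H] is the reflection sending w to w - 2 g(w,n)/N n. *)
  set H := 1%:M - (2 / N) *: (a *m n^T *m n).
  have nan : n *m a *m n^T = N%:M.
    by apply/rowP => i; rewrite !ord1 [RHS]mxE mulr1n.
  have HaH : H *m a *m H^T = a.
    set X := a *m n^T *m n.
    have aX : a *m X^T = X *m a by rewrite !trmx_mul trmxK lorentz_trmx !mulmxA.
    have XX : X *m (X *m a) = N *: (X *m a).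
      rewrite /X -!mulmxA (mulmxA n a) (mulmxA (n *m a) n^T) nan mul_scalar_mx.
      by rewrite !scalemxAr.
    have -> : H^T = 1%:M - (2 / N) *: X^T by rewrite linearB /= linearZ /= trmx1.
    rewrite /H -/X mulmxBr mulmx1 !mulmxBl mul1mx.
    rewrite -!scalemxAr -!scalemxAl -(mulmxA X a) aX XX !scalerA.
    by move: (X *m a) => Y; apply/matrixP => i j; rewrite !mxE; field.
  exists (P0 *m H); split.
  - rewrite unitmx_mul uP /=.
    have : H *m a *m H^T \in unitmx by rewrite HaH lorentz_unitmx.
    by rewrite !unitmx_mul => /andP[/andP[]].
  - by rewrite trmx_mul !mulmxA -(mulmxA P0) -(mulmxA P0) HaH.
  - rewrite row_mul -/p /H mulmxBr mulmx1 -scalemxAr !mulmxA.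
    rewrite (_ : p *m a *m n^T = (form a p n)%:M); last first.
      by apply/rowP => i; rewrite !ord1 [RHS]mxE mulr1n.
    rewrite mul_scalar_mx scalerA (_ : 2 / N * _ = 1) ?scale1r ?subKr //.
    (* Since [p] and [u] are both unit vectors, N = 2 g(p,n), so the reflection sends p to p - n =
       u. *)
    have NE : N = 2 * form a p n.
      by rewrite /N /n !form_lin gpp guu (form_sym u p); ring.
    by rewrite NE mulrAC -NE mulfV.
have gcv t : t ^+ 2 * form a v v = 1 -> form a (t *: v) (t *: v) = 1.
  by move=> <-; rewrite !form_lin mulrA.
have mc2 : (- c) ^+ 2 * form a v v = 1 by rewrite sqrrN.
have [gm|gm] := eqVneq (form a (p - c *: v) (p - c *: v)) 0; last first.
  have [P [? ? ?]] := reflected _ (gcv _ c2) gm.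
  by exists P; split=> //; exists c.
have [|P [? ? ?]] := reflected _ (gcv _ mc2); last first.
  by exists P; split=> //; exists (- c).
(* If p - c v is null, then g(p, c v) = 1, and p + c v has square 4. *)
move: gm (gcv _ c2); rewrite !form_lin gpp (form_sym v p) => gm gv.
rewrite (_ : _ + _ = 4) ?pnatr_eq0 //.
by move: gm gv; set x := form _ _ _; set y := form _ _ _ => gm gv; lra.
Qed.

(** In an orthonormal frame whose first vector is proportional to [v], orthogonality kills the time
    coordinate of [w], and minus a sum of squares remains. *)
Lemma form_orth_lt0 v w : 0 < form a v v -> form a v w = 0 -> w != 0 ->
  form a w w < 0.
Proof.
move=> /adapted_frame [P [uP PaP [c c2 Pv]]] vw w0.
set x := w *m invmx P; have wE : w = x *m P by rewrite mulmxKV.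
have gE (y z : 'rV[R]_4) :
    form a (y *m P) (z *m P) = (y *m eta *m z^T) 0 0.
  by rewrite /form trmx_mul !mulmxA -PaP !mulmxA.
have gs (y z : 'rV[R]_4) :
    form a (y *m P) (z *m P) = \sum_i y 0 i * z 0 i * (if i == 0 then 1 else -1).
  rewrite gE mul_mx_diag mxE; apply: eq_bigr => i _.
  by rewrite !mxE mulrAC.
have x00 : x 0 0 = 0.
  have: form a (row 0 P) w = 0 by rewrite Pv form_lin vw mulr0.
  rewrite rowE wE gs (bigD1 0) //= big1 ?addr0 => [|i /negbTE i0].
    by rewrite mxE !mulr1 mul1r.
  by rewrite mxE i0 /= !mul0r.
have -> : form a w w = - \sum_i (x 0 i) ^+ 2.
  rewrite wE gs -sumrN; apply: eq_bigr => i _.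
  by have [->|] := eqVneq i 0; rewrite ?x00 ?mulrN1 ?expr2 ?mul0r ?oppr0.
rewrite oppr_lt0 lt_def sumr_ge0 ?andbT => [|i _]; last exact: sqr_ge0.
apply: contra w0 => /eqP sx; suff -> : w = 0 by [].
rewrite wE (_ : x = 0) ?mul0mx //; apply/rowP => i; rewrite [RHS]mxE.
apply/eqP; rewrite -sqrf_eq0 (psumr_eq0P _ sx) // => j _; exact: sqr_ge0.
Qed.

(** The vector [z] is g(v,v) times the component of [w] orthogonal to [v], so its square is
    nonpositive; that square is g(v,v) times the difference of the two sides. *)
Lemma reverse_cauchy_schwarz v w : 0 < form a v v ->
  form a v v * form a w w <= form a v w ^+ 2.
Proof.
move=> v0; set z := form a v v *: w - form a v w *: v.
have vz : form a v z = 0 by rewrite /z !form_lin; ring.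
have : form a z z <= 0.
  have [->|z0] := eqVneq z 0; first by rewrite form0l.
  exact/ltW/(form_orth_lt0 v0).
have -> : form a z z =
    form a v v * (form a v v * form a w w - form a v w ^+ 2).
  by rewrite /z !form_lin (form_sym w v); ring.
by rewrite pmulr_rle0 // subr_le0.
Qed.

(** For timelike [k] this is the component of {A > 0} containing [k], cut out by a linear inequality
    instead of by connectedness. *)
Definition cone k := [set v | 0 < form a v v /\ 0 < form a k v].

Lemma cone_self k : 0 < form a k k -> cone k k.
Proof. by []. Qed.

(** If g(u,w) were nonpositive, the combination [z] of [w] and [k] orthogonal to the timelike [u]
    would itself be timelike. *)
Lemma cone_form_gt0 k u w : 0 < form a k k -> cone k u -> cone k w ->
  0 < form a u w.
Proof.
move=> kk [uu ku] [ww kw]; rewrite ltNge; apply/negP => uw.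
set z := form a u k *: w - form a u w *: k.
have zz : 0 < form a z z.
  rewrite /z !form_lin (form_sym u k) (form_sym w k).
  have nuw : 0 <= - form a u w by rewrite oppr_ge0.
  have ? := mulr_gt0 (mulr_gt0 ku ku) ww.
  have ? := mulr_ge0 (mulr_ge0 (ltW ku) (ltW kw)) nuw.
  have ? := mulr_ge0 (sqr_ge0 (form a u w)) (ltW kk).
  by nra.
have uz : form a u z = 0 by rewrite /z !form_lin; ring.
by have := form_orth_lt0 uu uz (form_neq0 zz); rewrite ltNge (ltW zz).
Qed.

Lemma cone_comb k u w (s t : R) : 0 < form a k k -> cone k u -> cone k w ->
  0 <= s -> 0 <= t -> 0 < s + t -> cone k (s *: u + t *: w).
Proof.
move=> kk Ku Kw s0 t0 st; have uw := cone_form_gt0 kk Ku Kw.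
case: Ku Kw => [uu ku] [ww kw]; rewrite /cone /= !form_lin (form_sym w u).
have [s1|s1] : s = 0 \/ 0 < s by move: s0; rewrite le_eqVlt => /orP[/eqP|]; auto.
  have t1 : 0 < t by rewrite s1 add0r in st.
  by rewrite s1 !(mul0r, mulr0, add0r) !mulr_gt0.
have ? := mulr_gt0 (mulr_gt0 s1 s1) uu.
have ? := mulr_ge0 (mulr_ge0 t0 t0) (ltW ww).
have ? := mulr_ge0 (mulr_ge0 s0 t0) (ltW uw).
have ? := mulr_gt0 s1 ku; have ? := mulr_ge0 t0 (ltW kw).
by split; nra.
Qed.

(** After squaring, only the cross terms differ, and they compare by the reverse Cauchy-Schwarz
    inequality. *)
Lemma cone_sqrt_concave k u w (s t : R) : 0 < form a k k ->
  cone k u -> cone k w -> 0 <= s -> 0 <= t ->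
  s * Num.sqrt (form a u u) + t * Num.sqrt (form a w w) <=
  Num.sqrt (form a (s *: u + t *: w) (s *: u + t *: w)).
Proof.
move=> kk Ku Kw s0 t0; have uw := cone_form_gt0 kk Ku Kw.
have [uu _] := Ku; have [ww _] := Kw.
set x := Num.sqrt _; set y := Num.sqrt (form a w w).
have xE : x ^+ 2 = form a u u by rewrite sqr_sqrtr // ltW.
have yE : y ^+ 2 = form a w w by rewrite sqr_sqrtr // ltW.
have x0 : 0 <= x by exact: sqrtr_ge0.
have y0 : 0 <= y by exact: sqrtr_ge0.
have xy : x * y <= form a u w.
  rewrite -(ler_pXn2r (_ : 0 < 2)%N) ?nnegrE ?mulr_ge0 ?(ltW uw) //.
  by rewrite exprMn xE yE reverse_cauchy_schwarz.
have l0 : 0 <= s * x + t * y by rewrite addr_ge0 ?mulr_ge0.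
rewrite -(ger0_norm l0) -sqrtr_sqr ler_wsqrtr //.
rewrite !form_lin (form_sym w u) -xE -yE.
have := ler_wpM2l (mulr_ge0 s0 t0) xy.
by nra.
Qed.

End Lorentz.

(** * Signs and norms of covectors on a timelike cone *)

Section LorentzCovector.
Variables (R : realType) (a : 'M[R]_4) (a_lorentz : lorentz_signature a).
Implicit Types (k n u v w : 'rV[R]_4) (t : R).
Local Notation g := (form a).
Local Notation g_sym := (form_sym a_lorentz).

(** Nondegeneracy gives a coordinate vector not orthogonal to [v]; scaling fixes the sign. This
    serves to push a null vector out of {A >= 0}. *)
Lemma form_lt0_exists v : v != 0 -> exists w, g v w < 0.
Proof.
move=> v0; have va0 : v *m a != 0.
  apply: contra v0 => /eqP va; rewrite -(mulmxK (lorentz_unitmx a_lorentz) v).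
  by rewrite va mul0mx.
have [i vi] : exists i, (v *m a) 0 i != 0.
  by apply/existsP; apply: contraR va0; rewrite negb_exists => /forallP z;
    apply/eqP/rowP => i; rewrite [RHS]mxE; apply/eqP; have := z i; rewrite negbK.
exists (- (v *m a) 0 i *: delta_mx 0 i).
by rewrite formZr form_delta mulNr oppr_lt0 -expr2 exprn_even_gt0.
Qed.

(** Two linear equations in four unknowns have a nonzero solution, which is spacelike by
    orthogonality to [v]. It is normalized so that v + w is null. *)
Lemma null_direction n v : 0 < g v v ->
  exists w, [/\ g v w = 0, g n w = 0 & g w w = - g v v].
Proof.
move=> v0; set N := row_mx (a *m v^T) (a *m n^T).
have rN : (\rank (kermx N) != 0)%N.
  by rewrite mxrank_ker -lt0n subn_gt0 (leq_ltn_trans (rank_leq_col _)).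
set u := nz_row (kermx N).
have u0 : u != 0 by rewrite nz_row_eq0 -mxrank_eq0.
have : u *m N = 0 by apply/sub_kermxP; rewrite nz_row_sub.
rewrite mul_mx_row -row_mx0 => /eq_row_mx[uv un].
have vu : g v u = 0 by rewrite g_sym /form -mulmxA uv mxE.
have nu : g n u = 0 by rewrite g_sym /form -mulmxA un mxE.
have uu := form_orth_lt0 a_lorentz v0 vu u0.
exists (Num.sqrt (g v v / - g u u) *: u); split.
- by rewrite formZr vu mulr0.
- by rewrite formZr nu mulr0.
- rewrite formZl formZr mulrA -expr2 sqr_sqrtr; last first.
    by rewrite divr_ge0 ?oppr_ge0 // ltW.
  by rewrite invrN mulrN mulNr mulfVK // lt_eqF.
Qed.

(** If g(n, .) took both signs on the cone, some vector of the convex cone would be orthogonal to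
    [n], making a nonzero [n] spacelike. *)
Lemma covector_sign n k : 0 < g k k -> 0 <= g n n ->
  (forall v, cone a k v -> g n v <= 0) \/ (forall v, cone a k v -> 0 <= g n v).
Proof.
move=> kk nn; have [|/existsNP[u /not_implyP[Ku /negP]]] :=
  pselect (forall v, cone a k v -> g n v <= 0); first by left.
rewrite -ltNge => nu; right => w Kw; rewrite leNgt; apply/negP => nw.
set z := g n u *: w + - g n w *: u.
have zz : 0 < g z z.
  have [] // := cone_comb a_lorentz kk Kw Ku (ltW nu) (_ : 0 <= - g n w) _.
    by rewrite oppr_ge0 ltW.
  by rewrite addr_gt0 ?oppr_gt0.
have nz : g n z = 0 by rewrite /z !form_lin; ring.
have [n0|n0] := eqVneq n 0; first by move: nu; rewrite n0 form0l ltxx.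
have := form_orth_lt0 a_lorentz zz (etrans (g_sym z n) nz) n0.
by rewrite ltNge nn.
Qed.

(** If [n] were spacelike, moving from [k] by a suitable negative multiple of [n] would make g(n, .)
    positive without leaving the cone. *)
Lemma covector_causal n k : 0 < g k k ->
  (forall v, cone a k v -> g n v <= 0) -> 0 <= g n n.
Proof.
move=> kk Kn; rewrite leNgt; apply/negP => nn.
have nk := Kn _ (cone_self kk).
(* Here [y] is the value that g(n, .) is to take at k + t n. Halving the square root makes q times A
   equal to -3 y^2 there, so A > 0 because q < 0. *)
set q := g n n in nn *; set y := Num.sqrt (g n k ^+ 2 - q * g k k) / 2.
have d0 : 0 < g n k ^+ 2 - q * g k k.
  by rewrite subr_gt0 (lt_le_trans _ (sqr_ge0 _)) // pmulr_llt0.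
have y0 : 0 < y by rewrite divr_gt0 // sqrtr_gt0.
have y2 : 4 * y ^+ 2 = g n k ^+ 2 - q * g k k.
  by rewrite /y expr_div_n sqr_sqrtr ?ltW //; field.
set t := (y - g n k) / q.
have tq : t * q = y - g n k by rewrite /t mulfVK // lt_eqF.
have t0 : t < 0 by rewrite nmulr_llt0 ?invr_lt0 // subr_gt0 (le_lt_trans nk).
have ny : g n (k + t *: n) = y by rewrite !form_lin -/q tq; ring.
suff : cone a k (k + t *: n) by move=> /Kn; rewrite ny leNgt y0.
have kky : 0 < g k (k + t *: n).
  rewrite !form_lin (g_sym k n) ltr_pwDl //.
  by rewrite mulr_le0 // ltW.
split=> //; rewrite !form_lin (g_sym k n) -/q tq.
rewrite -(nmulr_rlt0 _ nn).
have -> : q * (g k k + t * g n k + (t * g n k + t * (y - g n k))) =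
  q * g k k + (t * q) * (g n k + y) by ring.
rewrite tq; nra.
Qed.

(** If <n,n> >= 1, then [n] is timelike and the reverse Cauchy-Schwarz inequality gives g(n,v)^2 >=
    g(v,v). *)
Lemma covector_norm_lt1 n v : g n v ^+ 2 < g v v -> g n n < 1.
Proof.
move=> nv; rewrite ltNge; apply/negP => n1.
have := reverse_cauchy_schwarz a_lorentz v (lt_le_trans ltr01 n1).
have vv : 0 < g v v by exact: le_lt_trans (sqr_ge0 _) nv.
by rewrite leNgt => /negP; apply; rewrite (lt_le_trans nv) // ler_peMl // ltW.
Qed.

Lemma randers_cone_nonempty n k : 0 < g k k -> 0 <= g n n -> g n n < 1 ->
  (forall v, cone a k v -> g n v <= 0) ->
  exists2 v, cone a k v & g n v ^+ 2 < g v v.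
Proof.
move=> kk nn n1 Kn; have := Kn _ (cone_self kk).
rewrite le_eqVlt => /predU1P[nk|nk].
  by exists k; [exact: cone_self | rewrite nk expr0n].
set q := g n n in nn n1 *; set be := - g n k.
have be0 : 0 < be by rewrite oppr_gt0.
(* With this [d], the vector v = d k - n has g(n,v) = -1, while g(v,v) = d^2 g(k,k) + 2 - q exceeds
   1. *)
set d := (1 - q) / be.
have d0 : 0 < d by rewrite divr_gt0 // subr_gt0.
have dbe : d * be = 1 - q by rewrite mulfVK // gt_eqF.
set v := d *: k - n.
have nv : g n v = - d * be - q by rewrite /v !form_lin -/q /be; ring.
have vv : g v v = d ^+ 2 * g k k + 2 * d * be + q.
  by rewrite /v !form_lin (g_sym k n) -/q /be; ring.
have lt : g n v ^+ 2 < g v v.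
  rewrite nv vv; have := mulr_gt0 (exprn_gt0 2 d0) kk.
  by rewrite mulNr -mulrA dbe; nra.
exists v => //; split; first exact: le_lt_trans (sqr_ge0 _) lt.
by rewrite /v !form_lin (g_sym k n) -/be addr_gt0 // mulr_gt0.
Qed.

End LorentzCovector.

(** * Connectedness and extension by zero *)

Section Topology.
Variables (R : realType) (V : normedModType R).

Lemma convex_connected (E : set V) :
  (forall u v (s t : R), E u -> E v -> 0 <= s -> 0 <= t -> s + t = 1 ->
     E (s *: u + t *: v)) ->
  connected E.
Proof.
move=> cE; have [->|/set0P[u Eu]] := eqVneq E set0; first exact: connected0.
pose seg v := (fun t : R => (1 - t) *: u + t *: v) @` `[0, 1]%classic.
have segE v : E v -> seg v `<=` E.
  move=> Ev w [t]; rewrite /= in_itv /= => /andP[t0 t1] <-.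
  by apply: cE => //; rewrite ?subr_ge0 // subrK.
rewrite (_ : E = \bigcup_(v in E) seg v); last first.
  apply/seteqP; split=> [v Ev|v [w Ew /(segE _ Ew)]//].
  exists v => //; exists 1; first by rewrite /= in_itv /= ler01 lexx.
  by rewrite subrr scale0r add0r scale1r.
apply: bigcup_connected.
  exists u => v Ev; exists 0; first by rewrite /= in_itv /= ler01 lexx.
  by rewrite subr0 scale1r scale0r addr0.
move=> v Ev; apply: connected_continuous_connected.
  exact: segment_connected.
apply: continuous_subspaceT => t.
apply: cvgD; apply: cvgZr_tmp; last exact: cvg_id.
by apply: cvgB; [exact: cvg_cst | exact: cvg_id].
Qed.

(** The patched function is 0 at [p], so along [C] the values of [f] tend to 0 there; by continuity
    they also tend to [f p]. *)
Lemma extension0_boundary (f : V -> R) (C : set V) (p : V) :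
  {for p, continuous f} -> {within closure C, continuous (f \_ C)} ->
  closure C p -> ~ C p -> f p = 0.
Proof.
move=> cf /subspace_continuousP cfC Cp nCp; apply/eqP; apply: contrapT.
move=> /negP fp0; have e0 : 0 < `|f p| / 2 by rewrite divr_gt0 ?normr_gt0.
have /cvgrPdist_lt /(_ _ e0) near1 := cfC _ Cp.
rewrite near_withinE in near1.
have /cvgrPdist_lt /(_ _ e0) near2 := cf.
have [y [Cy [/(_ (subset_closure Cy)) y1 y2]]] :=
  Cp _ (@filterI _ (nbhs p) _ _ _ near1 near2).
move: y1; rewrite /from_subspace patchE memNset // patchE mem_set //.
rewrite sub0r normrN => y1.
have := ltrD y1 y2; rewrite -splitr addrC ltNge.
by rewrite -[X in `|X| <= _](subrK (f y)) ler_normD.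
Qed.

(** At a boundary point the patched function is bounded by |f|, which tends to 0. *)
Lemma extension0_continuous (f : V -> R) (C : set V) :
  open C -> continuous f -> (forall p, closure C p -> ~ C p -> f p = 0) ->
  {within closure C, continuous (f \_ C)}.
Proof.
move=> oC cf f0; apply/subspace_continuousP => p Cp.
apply: (@cvg_trans _ ((f \_ C) @ nbhs p)); first exact/cvg_app/cvg_within.
have [Cp'|nCp] := pselect (C p).
  rewrite /from_subspace patchE mem_set //; apply: cvg_trans (cf p).
  apply: near_eq_cvg; near=> y; rewrite patchE mem_set //.
  by near: y; exact: open_nbhs_nbhs.
rewrite /from_subspace patchE memNset //; apply/cvgrPdist_lt => e e0.
have /cvgrPdist_lt /(_ e e0) := cf p; rewrite f0 //.
apply: filterS => y; rewrite patchE; case: ifP => // _ _.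
by rewrite subrr normr0.
Unshelve. all: by end_near. Qed.

(** The set [C] is open in [E], and closed in it because it equals the trace of its closure on
    [E]. *)
Lemma connected_subset_eq (C E : set V) : connected E -> open C -> C !=set0 ->
  C `<=` E -> (forall p, E p -> closure C p -> C p) -> C = E.
Proof.
move=> cE oC C0 CE Ccl; apply: cE => //.
  by exists C => //; rewrite setIC; apply/esym/setIidPl.
exists (closure C); first exact: closed_closure.
apply/seteqP; split=> [p Cp|p [/Ccl]]; last exact.
by split; [exact: CE | exact: subset_closure].
Qed.

End Topology.

(** * Timelike cones in a single tangent space *)

Section RealContinuity.
Variables (R : realType) (T : topologicalType) (f h : T -> R) (x : T).
Hypotheses (cf : continuous_at x f) (ch : continuous_at x h).

Lemma real_continuousD : continuous_at x (fun y => f y + h y).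
Proof. exact: continuousD. Qed.

Lemma real_continuousB : continuous_at x (fun y => f y - h y).
Proof. exact: continuousB. Qed.

Lemma real_continuousM : continuous_at x (fun y => f y * h y).
Proof. exact: continuousM. Qed.

Lemma real_continuous_sqrt : continuous_at x (fun y => Num.sqrt (f y)).
Proof. by apply: (continuous_comp cf); exact: sqrt_continuous. Qed.

End RealContinuity.

Section Cones.
Variables (R : realType) (a : 'M[R]_4) (a_lorentz : lorentz_signature a).
(* The vector dual to the 1-form b, so that B = g n. *)
Variable n : 'rV[R]_4.
Implicit Types (k u v w : 'rV[R]_4) (t : R).
Local Notation g := (form a).
Local Notation g_sym := (form_sym a_lorentz).

Lemma form_continuous u : continuous (g u).
Proof.
rewrite (_ : g u = fun w => \sum_i (u *m a) 0 i * w 0 i).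
  apply: continuous_big => [|i _ v]; first exact: add_continuous.
  exact: cvgMl_tmp (@coord_continuous R 1 4 0 i v).
apply/funext => w; rewrite /form mxE; apply: eq_bigr => i _.
by congr (_ * _); rewrite mxE.
Qed.

Lemma quadratic_form_continuous : continuous (fun v => g v v).
Proof.
rewrite (_ : (fun w => g w w) =
    fun w => \sum_i g (delta_mx 0 i) w * w 0 i).
  apply: continuous_big => [|i _ v]; first exact: add_continuous.
  apply: real_continuousM; first exact: form_continuous.
  exact: (@coord_continuous R 1 4 0 i).
apply/funext => w; rewrite {1}/form mxE; apply: eq_bigr => i _.
by rewrite g_sym form_delta; congr (_ * _); rewrite mxE.
Qed.

Lemma open_fun_gt0 (T : topologicalType) (f : T -> R) : continuous f ->
  open [set v | 0 < f v].
Proof.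
move=> cf; rewrite (_ : mkset _ = f @^-1` [set x | 0 < x]) //.
by apply: open_comp => [v _|]; [exact: cf | exact: open_gt].
Qed.

Lemma closed_fun_ge0 (T : topologicalType) (f : T -> R) : continuous f ->
  closed [set v | 0 <= f v].
Proof.
move=> cf; rewrite (_ : mkset _ = f @^-1` [set x | 0 <= x]) //.
by apply: closed_comp => [v _|]; [exact: cf | exact: closed_ge].
Qed.

Lemma cone_open k : open (cone a k).
Proof.
apply: openI; apply: open_fun_gt0; first exact: quadratic_form_continuous.
exact: form_continuous.
Qed.

Lemma cone_connected k : 0 < g k k -> connected (cone a k).
Proof.
move=> kk; apply: convex_connected => u v s t Ku Kv s0 t0 st.
by apply: cone_comb => //; rewrite st.
Qed.

(** The cone is open and closed in [C]: on timelike vectors g(k, .) never vanishes, so its strict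
    and large positivity agree. *)
Lemma connected_subset_cone (C : set 'rV[R]_4) k v : connected C ->
  (forall w, C w -> 0 < g w w) -> C v -> cone a k v -> 0 < g k k ->
  C `<=` cone a k.
Proof.
move=> cC Cpos Cv Kv kk w Cw; suff CE : C `&` cone a k = C.
  by move: Cw; rewrite -{1}CE => -[].
apply: cC; first by exists v.
  by exists (cone a k); first exact: cone_open.
exists [set w | 0 <= g k w]; first exact/closed_fun_ge0/form_continuous.
apply/seteqP; split=> z [Cz] => [[_ kz]|/= kz]; split=> //; first exact: ltW.
split; first exact: Cpos.
rewrite lt_def kz andbT; apply/eqP => kz0.
have := form_orth_lt0 a_lorentz kk kz0 (form_neq0 (Cpos _ Cz)).
by rewrite ltNge ltW // Cpos.
Qed.

Lemma cone_component k : 0 < g k k ->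
  connected_component [set w | 0 < g w w] k = cone a k.
Proof.
move=> kk; apply/seteqP; split.
  apply: (@connected_subset_cone _ _ k) => //.
  - exact: component_connected.
  - by move=> w /connected_component_sub.
  - exact: connected_component_refl.
apply: connected_component_max; [exact: cone_self | by move=> w [] |].
exact: cone_connected.
Qed.

(** The square root of a negative number is 0 by default, so this is B where A <= 0 and it is
    continuous on the whole tangent space. *)
Definition randers_root v := Num.sqrt (g v v) + g n v.

Definition randers_form v := Num.sg (randers_root v) * randers_root v ^+ 2.

Lemma randers_root_continuous : continuous randers_root.
Proof.
rewrite /randers_root => v.
apply: real_continuousD; last exact: form_continuous.
by apply: real_continuous_sqrt; exact: quadratic_form_continuous.
Qed.

(** The sign jumps at 0; this form of the product makes continuity of L evident. *)
Lemma randers_form_norm v : randers_form v = randers_root v * `|randers_root v|.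
Proof. by rewrite /randers_form expr2 mulrCA -normrEsg. Qed.

Lemma randers_form_continuous : continuous randers_form.
Proof.
rewrite (_ : randers_form = fun v => randers_root v * `|randers_root v|).
  move=> v; apply: real_continuousM; first exact: randers_root_continuous.
  apply: continuous_comp (@norm_continuous _ _ _).
  exact: randers_root_continuous.
by apply/funext => v; exact: randers_form_norm.
Qed.

Lemma randers_form_gt0 v : (0 < randers_form v) = (0 < randers_root v).
Proof.
rewrite randers_form_norm; have [r0|r0|<-] := ltgtP 0 (randers_root v).
- by rewrite gtr0_norm // mulr_gt0.
- by rewrite ltr0_norm // mulrN oppr_gt0 ltNge mulr_le0 // ltW.
- by rewrite mul0r ltxx.
Qed.

Lemma randers_form_eq0 v : randers_form v = 0 -> randers_root v = 0.
Proof.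
by rewrite randers_form_norm => /eqP; rewrite mulf_eq0 normr_eq0 orbb => /eqP.
Qed.

Definition randers_cone k := cone a k `&` [set v | g n v ^+ 2 < g v v].

Lemma randers_root_gt0 v : 0 < g v v ->
  (0 < randers_root v) = (0 <= g n v) || (g n v ^+ 2 < g v v).
Proof.
move=> v0; rewrite /randers_root; have [nv|nv] := leP 0 (g n v).
  by rewrite ltr_wpDr // sqrtr_gt0.
rewrite -[g n v]opprK subr_gt0 sqrrN /=; set x := - g n v.
have x0 : 0 < x by rewrite oppr_gt0.
rewrite -(ltr_pXn2r (_ : 0 < 2)%N) ?nnegrE ?sqrtr_ge0 ?(ltW x0) //.
by rewrite sqr_sqrtr // ltW.
Qed.

(** * Necessity: the shape of a timelike cone meeting the cone of [k] *)

Section TimelikeCone.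
Variables (C : set 'rV[R]_4) (k : 'rV[R]_4).
Hypotheses (C_connected : connected C) (C_open : open C)
  (C_timelike : forall v, C v -> 0 < g v v)
  (C_pos : forall v, C v -> 0 < randers_form v)
  (C_extension : {within closure C, continuous (randers_form \_ C)})
  (kk : 0 < g k k) (C_meets : C `&` cone a k !=set0).

Lemma boundary_root_eq0 p : closure C p -> ~ C p -> randers_root p = 0.
Proof.
move=> Cp nCp; apply: randers_form_eq0.
by apply: extension0_boundary Cp nCp => //; exact: randers_form_continuous.
Qed.

Lemma timelike_cone_root : C = cone a k `&` [set v | 0 < randers_root v].
Proof.
apply: connected_subset_eq => //.
- apply: convex_connected => u v s t [Ku su] [Kv sv] s0 t0 st.
  split; first by apply: cone_comb => //; rewrite st.
  rewrite /= /randers_root [g n _]formDr [g n (s *: u)]formZr.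
  rewrite [g n (t *: v)]formZr.
  apply: (@lt_le_trans _ _ (s * randers_root u + t * randers_root v)); last first.
    rewrite /randers_root !mulrDr addrACA lerD2r.
    exact: (cone_sqrt_concave a_lorentz kk Ku Kv s0 t0).
  move: s0; rewrite le_eqVlt => /predU1P[s0|s0].
    by move: st; rewrite -s0 mul0r !add0r => ->; rewrite mul1r.
  by rewrite ltr_wpDr ?mulr_gt0 // mulr_ge0 // ltW.
- by case: C_meets => v [Cv _]; exists v.
- case: C_meets => v [Cv Kv] w Cw; split.
    exact: (connected_subset_cone C_connected C_timelike Cv Kv kk Cw).
  by rewrite /= -randers_form_gt0; exact: C_pos.
(* Relative closedness: a point of the closure outside [C] has root 0, not a positive one. *)
- move=> p [_ /= p0] Cp; apply: contrapT => /(boundary_root_eq0 Cp) p1.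
  by rewrite p1 ltxx in p0.
Qed.

(* Otherwise [B > 0] somewhere in the cone, and moving from there in a
   spacelike direction along which [B] is constant one reaches a boundary point
   with [sqrt A + B = B > 0]. *)
Lemma timelike_cone_covector v : cone a k v -> g n v <= 0.
Proof.
move=> Kv; rewrite leNgt; apply/negP => nv; have [vv kv] := Kv.
have [w [vw nw ww]] := null_direction a_lorentz n vv.
have Av t : g (v + t *: w) (v + t *: w) = (1 - t ^+ 2) * g v v.
  by rewrite !form_lin (g_sym w v) vw ww; ring.
have Bv t : g n (v + t *: w) = g n v by rewrite formDr formZr nw mulr0 addr0.
have inC t : 0 <= t < 1 -> C (v + t *: w).
  case/andP=> t0 t1; have Apos : 0 < g (v + t *: w) (v + t *: w).
    by rewrite Av mulr_gt0 // subr_gt0 expr_lt1.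
  rewrite timelike_cone_root; split; last first.
    by rewrite /= randers_root_gt0 // Bv ltW.
  (* Both [k] and v + t w lie in the cone of [v], because g(v, v + t w) = g(v,v); hence they pair
     positively. *)
  split=> //; apply: (cone_form_gt0 a_lorentz vv).
    by split; rewrite // g_sym.
  by split; rewrite // formDr formZr vw mulr0 addr0.
have clC : closure C (v + w).
  move=> B; rewrite -[w]scale1r => nB.
  have cl : (fun t => v + t *: w) @ nbhs (1 : R) --> v + (1 : R) *: w.
    by apply: cvgD; [exact: cvg_cst | apply: cvgZr_tmp; exact: cvg_id].
  have /nbhs_ballP[e /= e0 eB] := cl _ nB.
  pose d := Num.min (e / 2) 2^-1.
  have d0 : 0 < d by rewrite lt_min divr_gt0 //= invr_gt0 ltr0n.
  have de : d < e by rewrite gt_min ltr_pdivrMr ?ltr0n // ltr_pMr // ltr1n.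
  have d1 : d < 1 by rewrite gt_min invf_lt1 // ltr1n orbT.
  exists (v + (1 - d) *: w); split.
    by apply: inC; rewrite subr_ge0 ltW //= ltrBlDr ltrDl.
  by apply: eB; rewrite /ball /= subKr gtr0_norm.
have A0 : g (v + w) (v + w) = 0.
  by have := Av 1; rewrite scale1r expr1n subrr mul0r.
have nC : ~ C (v + w) by move=> /C_timelike; rewrite A0 ltxx.
have := boundary_root_eq0 clC nC; rewrite /randers_root A0 sqrtr0 add0r.
by have := Bv 1; rewrite scale1r => -> n0; rewrite n0 ltxx in nv.
Qed.

(** Once B <= 0 on the cone, positivity of sqrt A + B means A > B^2. *)
Lemma timelike_coneE : C = randers_cone k.
Proof.
rewrite timelike_cone_root; apply/seteqP; split=> v [Kv]; rewrite /= => sv.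
  split=> //=; have [vv kv] := Kv.
  move: sv; rewrite randers_root_gt0 // => /orP[nv|//].
  rewrite (_ : g n v = 0) ?expr0n //.
  by apply/eqP; rewrite eq_le nv timelike_cone_covector.
by split=> //=; have [vv _] := Kv; rewrite randers_root_gt0 // sv orbT.
Qed.

Lemma timelike_cone_norm : 0 <= g n n /\ g n n < 1.
Proof.
split; first exact: covector_causal kk timelike_cone_covector.
have [v [+ _]] := C_meets; rewrite timelike_coneE => -[_ /=].
exact: covector_norm_lt1.
Qed.

End TimelikeCone.

(** * Sufficiency in one tangent space: the cone A > B^2 *)

Lemma randers_cone_open k : open (randers_cone k).
Proof.
apply: openI; first exact: cone_open.
rewrite (_ : mkset _ = [set v | 0 < g v v - g n v ^+ 2]); last first.
  by apply/seteqP; split=> v /=; rewrite subr_gt0.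
apply: open_fun_gt0 => v.
apply: real_continuousB; first exact: quadratic_form_continuous.
by apply: real_continuousM; exact: form_continuous.
Qed.

(** The condition reads |B| < sqrt A, with |B| convex and sqrt A concave on the cone, so the set is
    convex. *)
Lemma randers_cone_connected k : 0 < g k k -> connected (randers_cone k).
Proof.
move=> kk; apply: convex_connected => u v s t [Ku nu] [Kv nv] s0 t0 st.
split; first by apply: cone_comb => //; rewrite st.
have lt w : cone a k w -> g n w ^+ 2 < g w w -> `|g n w| < Num.sqrt (g w w).
  by case=> ww _ nw; rewrite -sqrtr_sqr ltr_sqrt.
have {nu}nu := lt _ Ku nu; have {nv}nv := lt _ Kv nv.
set z := s *: u + t *: v; suff: `|g n z| < Num.sqrt (g z z).
  have st0 : 0 < s + t by rewrite st.
  have [zz _] := cone_comb a_lorentz kk Ku Kv s0 t0 st0.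
  by rewrite -sqrtr_sqr ltr_sqrt.
apply: lt_le_trans (cone_sqrt_concave a_lorentz kk Ku Kv s0 t0).
rewrite /z !form_lin; apply: le_lt_trans (ler_normD _ _) _.
rewrite !normrM (ger0_norm s0) (ger0_norm t0).
move: s0; rewrite le_eqVlt => /predU1P[s0|s0].
  by move: st; rewrite -s0 !mul0r !add0r => ->; rewrite !mul1r.
by rewrite ltr_leD ?ltr_pM2l // ler_wpM2l // ltW.
Qed.

(** The large inequalities survive in the closure; at a boundary point A = B^2 with B <= 0, so sqrt
    A = -B and L vanishes. *)
Lemma randers_cone_extension k : 0 < g k k ->
  (forall v, cone a k v -> g n v <= 0) ->
  {within closure (randers_cone k),
     continuous (randers_form \_ (randers_cone k))}.
Proof.
move=> kk Kn; apply: extension0_continuous.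
- exact: randers_cone_open.
- exact: randers_form_continuous.
- move=> p clp; set D := ([set v | 0 <= g v v - g n v ^+ 2] `&`
    [set v | 0 <= g k v]) `&` [set v | 0 <= - g n v].
  have cD : closed D.
    apply: closedI; [apply: closedI|]; apply: closed_fun_ge0 => v.
    - apply: real_continuousB; first exact: quadratic_form_continuous.
      by apply: real_continuousM; exact: form_continuous.
    - exact: form_continuous.
    - by apply: continuousN; exact: form_continuous.
  have [] : D p.
    apply: cD; apply: closureS clp => v [[vv kv] /= nv].
    split; first by split=> /=; rewrite ?subr_ge0 ltW.
    by rewrite /= oppr_ge0; exact: Kn.
  rewrite /= subr_ge0 oppr_ge0 => -[] pp kp np nCp.
  (* If A > B^2 at [p], then [p] is timelike, g(k,p) cannot vanish, and [p] would belong to the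
     cone. *)
  have pE : g p p = g n p ^+ 2.
    apply/eqP; rewrite eq_le pp andbT leNgt; apply/negP => lt; apply: nCp.
    split=> //; have p0 : 0 < g p p := le_lt_trans (sqr_ge0 _) lt.
    split=> //; rewrite lt_def kp andbT; apply/eqP => kp0.
    have := form_orth_lt0 a_lorentz kk kp0 (form_neq0 p0).
    by rewrite ltNge ltW.
  rewrite randers_form_norm /randers_root pE sqrtr_sqr ler0_norm //.
  by rewrite addNr mul0r.
Qed.

End Cones.

(** * Calculus of functions of class C^k on an open set *)

Section DirectionalDerivatives.
Variables (R : realType) (V : normedModType R).
Implicit Types (f : V -> R^o) (x v : V).

(** Restriction to the line through [x] in direction [v] reduces this to the chain rule in one
    variable. *)
Lemma is_derive_sqrt f x v (df : R) : 0 < f x -> is_derive x v f df ->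
  is_derive x v (fun y => Num.sqrt (f y) : R^o) (df / (2 * Num.sqrt (f x))).
Proof.
move=> fx0 [dfx dfE].
pose l (h : R) : R := f (h *: v + x).
have l0 : l 0 = f x by rewrite /l scale0r add0r.
have dl : derivable (l : R -> R) 0 1.
  by move: dfx => /derivable1P.
have [ds dsE] := @is_derive1_sqrt R _ fx0; rewrite -l0 in ds dsE.
have dls : derivable (Num.sqrt \o l : R -> R) 0 1.
  apply/derivable1_diffP/differentiable_comp; apply/derivable1_diffP.
    exact: dl.
  exact: ds.
apply: DeriveDef; first by apply/derivable1P.
have lineE (h : V -> R^o) : 'D_v h x = derive1 (fun t : R => h (t *: v + x)) 0.
  rewrite /derive1 /derive; set F := fun t => _; set G := fun t => _.
  suff -> : F = G by [].
  by apply/funext => t; rewrite /F /G /= addr0 scale0r add0r.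
rewrite lineE; have /= -> := derive1_comp dl ds.
by rewrite derive1E dsE -lineE dfE l0 mulrC.
Qed.

Lemma near_eq_differentiable (W : normedModType R) (f g : V -> W) x :
  (\near x, f x = g x) -> differentiable f x -> differentiable g x.
Proof.
move=> fg /diff_locallyP[dfc fE].
have gx : f x = g x := nbhs_singleton fg.
have gE : g \o shift x = cst (g x) + 'd f x +o_ 0 id.
  apply/eqaddoP => e e0; move/eqaddoP : fE => /(_ e e0) fE.
  have fg0 : \forall h \near (0 : V), f (h + x) = g (h + x).
    by move: fg; rewrite (near_shift 0 x) subr0.
  by apply: filterS2 fg0 fE => h /= fgh; rewrite !fctE /= fgh gx.
by apply/diff_locallyP; rewrite (diff_unique dfc gE).
Qed.

End DirectionalDerivatives.

Section CalculusOnOpen.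
Variables (R : realType) (V : normedModType R) (U : set V) (U_open : open U).
Implicit Types (f g : V -> R^o) (k : nat).

Lemma near_open (P : V -> Prop) x : U x -> (forall y, U y -> P y) ->
  \near x, P x.
Proof. by move=> Ux UP; apply: filterS UP _; exact: open_nbhs_nbhs. Qed.

(** On an open set agreement passes to derivatives, so in the rules below a derivative may be
    replaced by a formula valid on [U] only. *)
Lemma C_on_ext k f g : (forall x, U x -> f x = g x) -> C_on k U f -> C_on k U g.
Proof.
elim: k f g => [|k IH] f g fg /= => [cf x Ux|[df Df]].
  suff : g @ nbhs x --> g x by [].
  rewrite -fg //; apply: cvg_trans (cf x Ux).
  by apply: near_eq_cvg; apply: near_open Ux _ => y /fg.
split=> [x Ux|v].
  by apply: near_eq_differentiable (df x Ux); exact: near_open.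
by apply: IH (Df v) => x Ux; apply: near_eq_derive; exact: near_open.
Qed.

Lemma C_on_pred k f : C_on k.+1 U f -> C_on k U f.
Proof.
elim: k f => [|k IH] f [df Df].
  by move=> x Ux; apply: differentiable_continuous; exact: df.
by split=> // v; apply: IH; exact: Df.
Qed.

Lemma C_on_cst k (c : R^o) : C_on k U (fun=> c).
Proof.
elim: k c => [|k IH] c /=; first by move=> x _; exact: cvg_cst.
split=> [x _|v]; first exact: differentiable_cst.
by apply: C_on_ext (IH 0) => x _; rewrite derive_cst.
Qed.

Lemma C_onD k f g : C_on k U f -> C_on k U g -> C_on k U (fun x => f x + g x).
Proof.
elim: k f g => [|k IH] f g /=.
  by move=> cf cg x Ux; apply: cvgD; [exact: cf | exact: cg].
move=> [df Df] [dg Dg]; split=> [x Ux|v].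
  by apply: differentiableD; [exact: df | exact: dg].
apply: C_on_ext (IH _ _ (Df v) (Dg v)) => x Ux.
by rewrite -deriveD //; apply: diff_derivable; [exact: df | exact: dg].
Qed.

Lemma C_on_sum k n (f : 'I_n -> V -> R^o) : (forall i, C_on k U (f i)) ->
  C_on k U (fun x => \sum_i f i x).
Proof.
move=> Cf; elim: (index_enum _) => [|i s IH].
  by apply: C_on_ext (C_on_cst k 0) => x _; rewrite big_nil.
by apply: C_on_ext (C_onD (Cf i) IH) => x _; rewrite big_cons.
Qed.

Lemma C_onM k f g : C_on k U f -> C_on k U g -> C_on k U (fun x => f x * g x).
Proof.
elim: k f g => [|k IH] f g.
  by move=> cf cg x Ux; apply: cvgM; [exact: cf | exact: cg].
move=> Cf Cg; have [[df Df] [dg Dg]] := (Cf, Cg); split=> [x Ux|v].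
  by apply: differentiableM; [exact: df | exact: dg].
apply: C_on_ext (C_onD (IH _ _ (C_on_pred Cf) (Dg v))
                       (IH _ _ (C_on_pred Cg) (Df v))) => x Ux.
exact/esym/(deriveM (diff_derivable (df x Ux)) (diff_derivable (dg x Ux))).
Qed.

(** The derivative of 1/f is -(1/f)^2 times that of [f], so the induction hypothesis is applied to
    1/f itself, one order lower. *)
Lemma C_onV k f : (forall x, U x -> f x != 0) -> C_on k U f ->
  C_on k U (fun x => (f x)^-1).
Proof.
move=> f0; elim: k => [|k IH] Cf.
  by move=> x Ux; apply: cvgV; [exact: f0 | exact: Cf].
have [df Df] := Cf; split=> [x Ux|v].
  by apply: differentiableV; [exact: df | exact: f0].
have Cf' := IH (C_on_pred Cf).
apply: C_on_ext (C_onM (C_onM (C_on_cst k (-1)) (C_onM Cf' Cf')) (Df v)) => x Ux.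
rewrite deriveV ?f0 //; last exact/diff_derivable/df.
by rewrite mulN1r -invfM -expr2.
Qed.

Lemma C_on_sqrt k f : (forall x, U x -> 0 < f x) -> C_on k U f ->
  C_on k U (fun x => Num.sqrt (f x) : R^o).
Proof.
move=> f0; elim: k => [|k IH] Cf.
  by move=> x Ux; apply: (continuous_comp (Cf x Ux)); exact: sqrt_continuous.
have [df Df] := Cf; split=> [x Ux|v].
  apply: (@differentiable_comp _ _ _ _ f (@Num.sqrt R : R -> R)).
    exact: df.
  apply/derivable1_diffP; have [h _] := @is_derive1_sqrt R _ (f0 _ Ux).
  exact: h.
have s0 x : U x -> Num.sqrt (f x) != 0 by move=> Ux; rewrite gt_eqF ?sqrtr_gt0 ?f0.
apply: C_on_ext (C_onM (C_onM (C_on_cst k 2^-1)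
  (C_onV s0 (IH (C_on_pred Cf)))) (Df v)) => x Ux.
have h := derivableP (diff_derivable (v := v) (df x Ux)).
have := is_derive_sqrt (f0 _ Ux) h => -[_ ->].
by rewrite invfM mulrC.
Qed.

Lemma C_on_linear k (l : {linear V -> R^o}) : continuous l -> C_on k U l.
Proof.
move=> cl; case: k => [|k]; first by move=> x _; exact: cl.
have dl x : differentiable l x by exact: linear_differentiable.
split=> // v; apply: C_on_ext (C_on_cst k (l v)) => x _.
by rewrite deriveE // diff_lin.
Qed.

End CalculusOnOpen.

Lemma C_on_fst (R : realType) (V W : normedModType R) k (U : set V)
    (f : V -> R^o) :
  C_on k U f -> C_on k [set z : V * W | U z.1] (fun z => f z.1).
Proof.
elim: k f => [|k IH] f /=.
  move=> cf z Uz; apply: (@continuous_comp _ _ _ fst f); last exact: cf.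
  exact: cvg_fst.
move=> [df Df]; split=> [z Uz|v].
  apply: (@differentiable_comp _ _ _ _ fst f); last exact: df.
  by apply: linear_differentiable => y; exact: cvg_fst.
(* The difference quotients of [f] after the projection, along [v], are those of [f] along [v.1]. *)
exact: IH (Df v.1).
Qed.

Lemma C_onS (R : realType) (V W : normedModType R) k (U U' : set V)
    (f : V -> W) :
  U' `<=` U -> C_on k U f -> C_on k U' f.
Proof.
move=> UU'; elim: k f => [|k IH] f /=; first by move=> cf x /UU'; exact: cf.
by move=> [df Df]; split=> [x /UU'|v]; [exact: df | exact: IH].
Qed.

(** * The Hessian of the Randers-type form *)

Section Hessian.
Variables (R : realType) (a : 'M[R]_4) (a_lorentz : lorentz_signature a).
Variable n : 'rV[R]_4.
Implicit Types (e u v w x y : 'rV[R]_4).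
Local Notation g := (form a).
Local Notation g_sym := (form_sym a_lorentz).
Local Notation s := (randers_root a n).

(** Along a line a polynomial of degree at most two has a difference quotient affine in [h], which
    covers linear and quadratic forms. *)
Lemma is_derive_of_expansion (f : 'rV[R]_4 -> R^o) v e (df c : R) :
  (forall h : R, f (h *: e + v) - f v = h * (df + h * c)) ->
  is_derive v e f df.
Proof.
move=> fE; have cc : {for 0, continuous (fun h : R => df + h * c)}.
  apply: real_continuousD; first exact: cvg_cst.
  by apply: real_continuousM; [exact: cvg_id | exact: cvg_cst].
move: cc => /continuous_withinNx; rewrite mul0r addr0 => cc.
have cf : h^-1 *: ((f \o shift v) (h *: e) - f v) @[h --> 0^'] --> (df : R^o).
  apply: cvg_trans cc; apply: near_eq_cvg; near=> h.
  have h0 : h != 0 by near: h; exact: nbhs_dnbhs_neq.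
  by rewrite /= fE /GRing.scale /= mulKf.
by apply: DeriveDef; [apply/cvg_ex; exists df | exact: cvg_lim].
Unshelve. all: by end_near. Qed.

Lemma is_derive_form u v e : is_derive v e (g u : _ -> R^o) (g u e).
Proof.
by apply: (@is_derive_of_expansion _ _ _ _ 0) => h; rewrite !form_lin; ring.
Qed.

Lemma is_derive_quadratic_form v e :
  is_derive v e (fun w => g w w : R^o) (2 * g v e).
Proof.
apply: (@is_derive_of_expansion _ _ _ _ (g e e)) => h.
by rewrite !form_lin (g_sym e v); ring.
Qed.

Lemma is_derive_quadratic_sqrt v e : 0 < g v v ->
  is_derive v e (fun w => Num.sqrt (g w w) : R^o) (g v e / Num.sqrt (g v v)).
Proof.
move=> vv; have F0 : Num.sqrt (g v v) != 0 by rewrite gt_eqF ?sqrtr_gt0.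
have h := @is_derive_sqrt _ _ (fun w => g w w) _ _ _ vv
  (is_derive_quadratic_form v e).
by apply: is_derive_eq h _; field.
Qed.

Lemma is_derive_root v e : 0 < g v v ->
  is_derive v e (s : _ -> R^o) (g v e / Num.sqrt (g v v) + g n e).
Proof.
move=> vv.
exact: is_deriveD (is_derive_quadratic_sqrt e vv) (is_derive_form n v e).
Qed.

(* The differential of [sqrt A + B] at [v] is [g (root_grad v)]. *)
Definition root_grad v := (Num.sqrt (g v v))^-1 *: v + n.

Lemma root_gradE v e : g (root_grad v) e = g v e / Num.sqrt (g v v) + g n e.
Proof. by rewrite /root_grad !form_lin mulrC. Qed.

Lemma root_grad_self v : 0 < g v v -> g (root_grad v) v = s v.
Proof.
move=> vv; rewrite root_gradE /randers_root -{1}(sqr_sqrtr (ltW vv)) expr2 mulfK //.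
by rewrite gt_eqF ?sqrtr_gt0.
Qed.

Lemma near_timelike v : 0 < g v v -> 0 < s v ->
  \near v, 0 < g v v /\ 0 < s v.
Proof.
move=> vv sv; apply: filterI.
  have := open_fun_gt0 (quadratic_form_continuous a_lorentz).
  by rewrite openE; apply.
have := open_fun_gt0 (randers_root_continuous a_lorentz (n := n)).
by rewrite openE; apply.
Qed.

Lemma derive_randers_form v e : 0 < g v v -> 0 < s v ->
  'D_e (randers_form a n : _ -> R^o) v = 2 * (s v * g (root_grad v) e).
Proof.
move=> vv sv; have h := is_derive_root e vv.
(* Near [v] the sign is 1, so L is the square of [s] there. *)
rewrite (@near_eq_derive _ _ _ _ (fun w => s w * s w : R^o)); last first.
  by apply: filterS (near_timelike vv sv) => w [_ sw];
    rewrite randers_form_norm gtr0_norm.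
have [_ ->] := is_deriveM h h.
by rewrite root_gradE /GRing.scale /=; ring.
Qed.

Lemma derive2_randers_form v e1 e2 : 0 < g v v -> 0 < s v ->
  'D_e1 (fun w => 'D_e2 (randers_form a n : _ -> R^o) w) v =
  2 * (g (root_grad v) e1 * g (root_grad v) e2 +
       s v / Num.sqrt (g v v) * (g e1 e2 - g v e1 * g v e2 / g v v)).
Proof.
move=> vv sv.
have F0 : Num.sqrt (g v v) != 0 by rewrite gt_eqF ?sqrtr_gt0.
rewrite (@near_eq_derive _ _ _ _
  (fun w => 2 * (s w * (g e2 w * (Num.sqrt (g w w))^-1 + g n e2)) : R^o)); last first.
  apply: filterS (near_timelike vv sv) => w [ww sw].
  by rewrite derive_randers_form // root_gradE (g_sym e2 w).
have hs := is_derive_root e1 vv.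
have hF := is_derive_quadratic_sqrt e1 vv.
have hV : is_derive v e1 (fun w => (Num.sqrt (g w w))^-1 : R^o)
    (- Num.sqrt (g v v) ^- 2 * (g v e1 / Num.sqrt (g v v))).
  have [dF FE] := hF; apply: DeriveDef; first exact: derivableV.
  by rewrite deriveV // FE; congr (_ * _); field.
have h := is_deriveM (is_derive_cst (2 : R^o) v e1) (is_deriveM hs (is_deriveD
  (is_deriveM (is_derive_form e2 v e1) hV) (is_derive_cst (g n e2 : R^o) v e1))).
have [_ ->] := h.
rewrite !root_gradE /GRing.scale /= !fctE (g_sym e2 e1) !(g_sym e2 v).
have vE := sqr_sqrtr (ltW vv); rewrite /randers_root.
move: F0 vE; move: (Num.sqrt (g v v)) => F F0 <-.
by field.
Qed.

Lemma form_add (b c : 'M[R]_4) x y : form (b + c) x y = form b x y + form c x y.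
Proof. by rewrite /form mulmxDr mulmxDl mxE. Qed.

Lemma form_scale t (b : 'M[R]_4) x y : form (t *: b) x y = t * form b x y.
Proof. by rewrite /form -scalemxAr -scalemxAl mxE. Qed.

Lemma form_rank1 u x y : form ((u *m a)^T *m (u *m a)) x y = g u x * g u y.
Proof.
rewrite /form mulmxA -mulmxA mxE big_ord1; congr (_ * _).
rewrite -[LHS](_ : ((x *m (u *m a)^T)^T) 0 0 = _); last by rewrite mxE.
by rewrite trmx_mul trmxK.
Qed.

Lemma form_deltas (b : 'M[R]_4) i j :
  form b (delta_mx 0 i) (delta_mx 0 j) = b i j.
Proof. by rewrite form_delta -rowE mxE. Qed.

(** The entrywise second derivatives assemble into a matrix identity, so the Hessian can be
    evaluated on any frame. *)
Lemma randers_hessian_form v x y : 0 < g v v -> 0 < s v ->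
  form (\matrix_(i, j) (2^-1 * 'D_(delta_mx 0 i) (fun w =>
    'D_(delta_mx 0 j) (randers_form a n : _ -> R^o) w) v)) x y =
  g (root_grad v) x * g (root_grad v) y +
    s v / Num.sqrt (g v v) * (g x y - g v x * g v y / g v v).
Proof.
move=> vv sv; set H := \matrix_(_, _) _; set l := root_grad v.
set r := s v / Num.sqrt (g v v).
have -> : H = (l *m a)^T *m (l *m a) +
    r *: (a + (- (g v v)^-1) *: ((v *m a)^T *m (v *m a))).
  apply/matrixP => i j; rewrite -[RHS]form_deltas.
  rewrite form_add form_scale form_add form_scale !form_rank1.
  rewrite mxE derive2_randers_form // mulKf ?pnatr_eq0 //.
  by rewrite mulNr [_^-1 * _]mulrC.
rewrite form_add form_scale form_add form_scale !form_rank1.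
by rewrite mulNr [_^-1 * _]mulrC.
Qed.

Lemma randers_hessian_lorentz v : 0 < g v v -> 0 < s v ->
  lorentz_signature (\matrix_(i, j) (2^-1 *
    'D_(delta_mx 0 i) (fun w =>
       'D_(delta_mx 0 j) (randers_form a n : _ -> R^o) w) v)).
Proof.
move=> vv sv; set H := \matrix_(_, _) _.
have F0 : 0 < Num.sqrt (g v v) by rewrite sqrtr_gt0.
have := fun x y => randers_hessian_form x y vv sv; rewrite -/H.
have := root_grad_self vv.
move: (root_grad v) (Num.sqrt _) F0 => l F F0 lv HE.
have [Q [uQ QaQ [c c2 Qv]]] := adapted_frame a_lorentz vv.
have c0 : c != 0.
  by apply: contra_eq_neq c2 => ->; rewrite expr0n mul0r eq_sym oner_eq0.
have vQ i : i != 0 -> g v (row i Q) = 0.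
  move=> i0; apply: (mulfI c0); rewrite mulr0 -formZl -Qv form_row QaQ.
  by rewrite !mxE eq_sym (negbTE i0).
(* The second term of the Hessian kills [v], and [l] takes the value [s v] on it, so v / s has
   square 1. Subtracting a multiple of [v] from the other frame vectors puts them in the kernel of
   [l] without changing the second term; the factor sqrt(F / s) makes their squares -1. *)
pose p i : 'rV[R]_4 := if i == 0 then (s v)^-1 *: v else
  Num.sqrt (F / s v) *: (row i Q - (g l (row i Q) / s v) *: v).
pose P := \matrix_(i < 4) p i.
have lp i : i != 0 -> g l (p i) = 0.
  move=> /negbTE i0; rewrite /p i0 !form_lin lv mulfVK ?subrr ?mulr0 //.
  by rewrite gt_eqF.
have PHP : P *m H *m P^T = diag_mx (\row_(j < 4) if j == 0 then 1 else -1).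
  apply/matrixP => i j; rewrite -form_row !rowK HE.
  have s0 : s v != 0 by rewrite gt_eqF.
  have g0 : g v v != 0 by rewrite gt_eqF.
  have [->|i0] := eqVneq i 0; have [->|j0] := eqVneq j 0.
  - rewrite !mxE /= mulr1n /p /= !form_lin lv mulVf // mulr1.
    by rewrite -[RHS]addr0; congr (_ + _); field; rewrite s0 g0 gt_eqF.
  - rewrite (lp _ j0) mulr0 add0r !mxE /= (negbTE (_ : 0 != j)) ?(eq_sym 0) //.
    rewrite /= mulr0n /p (negbTE j0) /= !form_lin.
    by field; rewrite s0 g0 gt_eqF.
  - rewrite (lp _ i0) mul0r add0r !mxE (negbTE i0) mulr0n.
    rewrite /p (negbTE i0) /= !form_lin (g_sym _ v).
    by field; rewrite s0 g0 gt_eqF.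
  - rewrite (lp _ i0) mul0r add0r /p (negbTE i0) (negbTE j0).
    rewrite !form_lin (g_sym (row i Q) v) !vQ // form_row.
    have t2 := sqr_sqrtr (ltW (divr_gt0 F0 sv)).
    rewrite QaQ; move: t2; move: (Num.sqrt (F / s v)) => t t2.
    transitivity (s v / F * t ^+ 2 *
      diag_mx (\row_(j < 4) if j == 0 then 1 else -1) i j).
      by field; rewrite g0 s0 gt_eqF.
    by rewrite t2; field; rewrite s0 gt_eqF.
have uP : P *m H *m P^T \in unitmx.
  rewrite PHP unitmxE det_diag unitfE; apply/prodf_neq0 => i _.
  by rewrite mxE; case: ifP; rewrite ?oppr_eq0 oner_neq0.
by exists P => //; move: uP; rewrite !unitmx_mul => /andP[/andP[]].
Qed.

End Hessian.

(** * Topology of the tangent bundle *)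

Section PairContinuity.
Variables X Y : topologicalType.

Lemma pairl_continuous (y : Y) : continuous (fun x : X => (x, y)).
Proof. by move=> x; apply: cvg_pair; [exact: cvg_id | exact: cvg_cst]. Qed.

Lemma pairr_continuous (x : X) : continuous (fun y : Y => (x, y)).
Proof. by move=> y; apply: cvg_pair; [exact: cvg_cst | exact: cvg_id]. Qed.

End PairContinuity.

Section TangentTopology.
Variables (R : realType) (M : manifold R).
Implicit Types (x : M) (v : 'rV[R]_4) (Q T : set (tangent M)).

(** The transition from a chart to itself is the identity near the point, hence so is its Jacobian
    there. *)
Lemma frame_chart_at x : frame (chart_at x) (chart_at x x) = 1%:M.
Proof.
set c := chart_at x; have cx : chart_dom c x := chart_at_dom x.
rewrite /frame chart_mapK // -/c.
have cod : chart_cod c (c x) by exists x.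
have [dt _] := atlas_smooth (chart_at_atlas x) (chart_at_atlas x) 1.
have dtx : differentiable (transition c c) (c x).
  by apply: dt; rewrite /= chart_mapK.
have near_id : \forall xi \near c x, transition c c xi = id xi.
  have := @chart_cod_open _ _ c; rewrite openE => /(_ _ cod).
  by apply: filterS => y [z cz <-]; rewrite /transition chart_mapK.
apply/row_matrixP => i; rewrite !rowE mulmx1 -deriveEjacobian //.
by rewrite (near_eq_derive _ near_id) derive_id.
Qed.

Lemma tangent_of_chart_at x v :
  tangent_of (chart_at x) (chart_at x x, v) = Tangent x v.
Proof.
rewrite /tangent_of /= chart_mapK ?frame_chart_at ?mulmx1 //.
exact: chart_at_dom.
Qed.

Lemma open_tangentE Q : open Q -> tangent_open Q.
Proof. by []. Qed.

Lemma fiber_open Q x : open Q -> open (fiber Q x).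
Proof.
move=> /open_tangentE /(_ _ (chart_at_atlas x)) oQ.
rewrite (_ : fiber Q x = (fun v => (chart_at x x, v)) @^-1`
    tangent_coords (chart_at x) Q).
  by apply: open_comp => [v _|]; [exact: pairr_continuous | exact: oQ].
apply/seteqP; split=> v; rewrite /fiber /tangent_coords /= tangent_of_chart_at.
  by split=> //; exists x => //; exact: chart_at_dom.
by case.
Qed.

(** With the coordinate vector held fixed in a chart, moving the base point slightly stays in
    [Q]. *)
Lemma base_open Q : open Q -> open [set x | fiber Q x !=set0].
Proof.
move=> /open_tangentE oQ; rewrite openE => x [v Qv].
set c := chart_at x; have cx : chart_dom c x := chart_at_dom x.
pose S := [set xi | tangent_coords c Q (xi, v)].
have oS : open S.
  apply: (@open_comp _ _ (fun xi => (xi, v))); last exact: oQ (chart_at_atlas x).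
  by move=> y _; exact: pairl_continuous.
have Sx : S (c x).
  by split=> /=; [exists x | rewrite tangent_of_chart_at].
have nS : nbhs x (c @^-1` S).
  have := @chart_map_continuous _ _ c.
  rewrite continuous_open_subspace; last first.
    exact: chart_dom_open.
  move=> /(_ x); rewrite inE => /(_ cx) cc.
  by have := cc _ (open_nbhs_nbhs (conj oS Sx)); rewrite nbhs_filterE fmapE.
have nd : nbhs x (chart_dom c).
  by apply: open_nbhs_nbhs; split=> //; exact: chart_dom_open.
apply: (@filterS2 _ (nbhs x) _ _ _ _ _ nS nd) => y [_ /= Qy] dy.
by exists (v *m frame c (c y)); move: Qy; rewrite /tangent_of /= chart_mapK.
Qed.

(** An open and closed part of [T] contains each connected fiber entirely or misses it. The base
    points of the two kinds form open sets, since the projection is open, and [M] is connected. *)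
Lemma connected_tangent T : connected [set: M] -> open T ->
  (forall x, fiber T x !=set0) -> (forall x, connected (fiber T x)) ->
  connected T.
Proof.
move=> cM oT T0 cT B [p Bp] [C oC BC] [D cD BD].
have fB x : fiber B x !=set0 -> fiber B x = fiber T x.
  move=> B0; apply: cT => //.
    by exists (fiber C x); [exact: fiber_open | rewrite BC].
  exists (fiber D x); last by rewrite BD.
  by rewrite -openC; apply: (@fiber_open (~` D)); rewrite openC.
have BT : [set x | fiber B x !=set0] = [set: M].
  apply: cM; first by exists (base p); exists (vec p); rewrite /fiber; case: (p) Bp.
    exists [set x | fiber B x !=set0]; last by rewrite setTI.
    by apply: base_open; rewrite BC; exact: openI.
  exists [set x | fiber B x !=set0]; last by rewrite setTI.
  rewrite -openC.
  rewrite (_ : ~` _ = [set x | fiber (T `&` ~` D) x !=set0]).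
    by apply: base_open; apply: openI => //; rewrite openC.
  apply/seteqP; split=> x /= => [nB|[v [Tv nDv]] /fB/seteqP[_ /(_ _ Tv)]].
    have [v Tv] := T0 x; exists v; split=> // Dv; apply: nB; exists v.
    by rewrite BD.
  by rewrite /fiber /= BD => -[].
apply/seteqP; split=> q; first by rewrite BC => -[].
have /seteqP[_ /(_ (base q) I)/= /fB/seteqP[_ sub]] := BT.
by have := sub (vec q); rewrite /fiber /=; case: (q).
Qed.

Lemma chart_cod_tangent_open (c : chart R M) :
  open [set z : 'rV[R]_4 * 'rV[R]_4 | chart_cod c z.1].
Proof.
by apply: open_comp => [z _|]; [exact: cvg_fst | exact: chart_cod_open].
Qed.

Lemma open_tangent_gt0 (f : tangent M -> R) :
  (forall c, atlas c -> C_on 0 [set z : 'rV[R]_4 * 'rV[R]_4 | chart_cod c z.1]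
     (fun z => f (tangent_of c z) : R^o)) ->
  open [set p | 0 < f p].
Proof.
move=> cf; suff : tangent_open [set p | 0 < f p] by [].
move=> c ac; rewrite openE => z [cz /= fz].
have h1 : nbhs z [set y | chart_cod c y.1].
  have h := (@open_nbhs_nbhs _ z _ (conj (@chart_cod_tangent_open c) cz)).
  exact: h.
have h2 : nbhs z [set y | 0 < f (tangent_of c y)].
  have fz' := @open_nbhs_nbhs _ (f (tangent_of c z)) _ (conj (@open_gt R 0) fz).
  have := cf c ac z cz _ fz'.
  by rewrite nbhs_filterE fmapE.
by apply: (@filterS2 _ (nbhs z) _ _ _ _ _ h1 h2) => y ? ?; split.
Qed.

End TangentTopology.

(** * Randers-type deformations on a manifold *)

Section RandersManifold.
Variables (R : realType) (M : manifold R).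
Variables (a : M -> 'M[R]_4) (a_lorentzian : lorentzian_metric a).
Variables (b : M -> 'rV[R]_4) (b_form : one_form b).
Implicit Types (x : M) (v w : 'rV[R]_4) (Q : set (tangent M)).
Local Notation D := (randers_dom a).
Local Notation L := (randers a b).
Local Notation over c :=
  [set z : 'rV[R]_4 * 'rV[R]_4 | chart_cod c z.1].

Let a_lorentz x : lorentz_signature (a x).
Proof. by case: a_lorentzian. Qed.

Definition covector_dual x := b x *m invmx (a x).
Local Notation n := covector_dual.

Lemma pairingE x v : pairing b (Tangent x v) = form (a x) (n x) v.
Proof. by rewrite /form /n mulmxKV ?lorentz_unitmx. Qed.

Lemma dual_normE x : dual_norm a b x = form (a x) (n x) (n x).
Proof.
rewrite -pairingE /dual_norm /pairing /= -/(n x).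
rewrite (_ : b x *m (n x)^T = (n x *m (b x)^T)^T); first by rewrite [in RHS]mxE.
by rewrite [RHS]trmx_mul trmxK.
Qed.

Lemma randersE x :
  (fun v => L (Tangent x v)) = randers_form (a x) (n x).
Proof. by apply/funext => v; rewrite /randers pairingE. Qed.

Lemma vertical_hessian_lorentz x v : 0 < form (a x) v v ->
  0 < randers_root (a x) (n x) v ->
  lorentz_signature (vertical_hessian L (Tangent x v)).
Proof.
move=> vv sv; have := randers_hessian_lorentz (a_lorentz x) vv sv.
by rewrite -randersE.
Qed.

Lemma vec_coord_smooth (c : chart R M) k i :
  C_on k (over c) (fun z => z.2 0 i : R^o).
Proof.
have lin : linear (fun z : 'rV[R]_4 * 'rV[R]_4 => z.2 0 i : R^o).
  by move=> t z z'; rewrite !mxE.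
pose lM := GRing.isLinear.Build _ _ _ _ _ lin.
pose l : {linear ('rV[R]_4 * 'rV[R]_4)%type -> R^o} :=
  HB.pack (fun z : 'rV[R]_4 * 'rV[R]_4 => z.2 0 i : R^o) lM.
apply: (@C_on_linear _ _ _ (@chart_cod_tangent_open _ _ c) k l) => z.
apply: (@continuous_comp _ _ _ snd (fun w => w 0 i)); first exact: cvg_snd.
exact: coord_continuous.
Qed.

Lemma quad_smooth (c : chart R M) k : atlas c ->
  C_on k (over c) (fun z => quad a (tangent_of c z) : R^o).
Proof.
move=> ac; have oU := @chart_cod_tangent_open _ _ c.
pose G (xi : 'rV[R]_4) := frame c xi *m a (chart_inv c xi) *m (frame c xi)^T.
have CG i j : C_on k (over c) (fun z => G z.1 i j : R^o).
  have [_ sm] := a_lorentzian; exact: (@C_on_fst _ _ _ _ _ _ (sm c ac i j k)).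
apply: (@C_on_ext _ _ _ oU _ (fun z : 'rV[R]_4 * 'rV[R]_4 =>
    \sum_j (\sum_i z.2 0 i * G z.1 i j) * z.2 0 j)).
  move=> z _.
  have -> : quad a (tangent_of c z) = (z.2 *m G z.1 *m z.2^T) 0 0.
    by rewrite /quad /tangent_of /= trmx_mul /G !mulmxA.
  move: (G z.1) => g; rewrite mxE; apply: eq_bigr => j _; rewrite mxE.
  by congr (_ * _); rewrite mxE.
apply: C_on_sum => // j; apply: C_onM => //; last exact: vec_coord_smooth.
by apply: C_on_sum => // i; apply: C_onM => //; exact: vec_coord_smooth.
Qed.

Lemma pairing_smooth (c : chart R M) k : atlas c ->
  C_on k (over c) (fun z => pairing b (tangent_of c z) : R^o).
Proof.
move=> ac; have oU := @chart_cod_tangent_open _ _ c.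
pose G (xi : 'rV[R]_4) := b (chart_inv c xi) *m (frame c xi)^T.
apply: (@C_on_ext _ _ _ oU _ (fun z : 'rV[R]_4 * 'rV[R]_4 =>
    \sum_i G z.1 0 i * z.2 0 i)).
  move=> z _.
  have -> : pairing b (tangent_of c z) = (G z.1 *m z.2^T) 0 0.
    by rewrite /pairing /tangent_of /= trmx_mul /G !mulmxA.
  move: (G z.1) => g; rewrite mxE; apply: eq_bigr => j _.
  by congr (_ * _); rewrite mxE.
apply: C_on_sum => // i; apply: C_onM => //; last exact: vec_coord_smooth.
exact: (@C_on_fst _ _ _ _ _ _ (b_form ac i k)).
Qed.

Definition root_tangent (p : tangent M) := Num.sqrt (quad a p) + pairing b p.

Lemma root_tangentE x v :
  root_tangent (Tangent x v) = randers_root (a x) (n x) v.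
Proof. by rewrite /root_tangent pairingE. Qed.

(* The largest conic subbundle on which [L] is smooth and positive. *)
Definition randers_domain : set (tangent M) :=
  [set p | 0 < quad a p] `&` [set p | 0 < root_tangent p].

Lemma randers_domain_open : open randers_domain.
Proof.
apply: openI; apply: open_tangent_gt0 => c ac; first exact: quad_smooth.
move=> z Uz; apply: real_continuousD; last exact: (pairing_smooth 0 ac).
by apply: real_continuous_sqrt; exact: (quad_smooth 0 ac).
Qed.

Lemma open_randers_cones : open [set p | 0 < quad a p - pairing b p ^+ 2].
Proof.
apply: open_tangent_gt0 => c ac z Uz.
apply: real_continuousB; first exact: (quad_smooth 0 ac).
by apply: real_continuousM; exact: (pairing_smooth 0 ac).
Qed.

Lemma randers_smooth : smooth_tangent randers_domain L.
Proof.
move=> c ac k; set U := tangent_coords c _.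
have oU : open U.
  by have : tangent_open randers_domain := randers_domain_open; exact.
have sub : U `<=` over c by move=> z [].
have CA := C_onS sub (quad_smooth k ac).
have CB := C_onS sub (pairing_smooth k ac).
have Cs : C_on k U (fun z => root_tangent (tangent_of c z) : R^o).
  by apply: C_onD => //; apply: C_on_sqrt => // z [_ []].
apply: C_on_ext (C_onM oU Cs Cs) => // z [_ [_ sz]].
by rewrite /randers -/(root_tangent _) gtr0_sg // mul1r expr2.
Qed.

Lemma timelike_exists x : exists v, 0 < form (a x) v v.
Proof.
have [P _ PaP] := a_lorentz x; exists (row 0 P).
by rewrite form_row PaP !mxE /= mulr1n.
Qed.

Lemma pseudo_finsler_randers : [set: M] !=set0 ->
  pseudo_finsler D L randers_domain.
Proof.
case=> x0 _.
have scale x v t : 0 < t -> root_tangent (Tangent x (t *: v)) =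
    t * root_tangent (Tangent x v).
  move=> t0; rewrite !root_tangentE /randers_root !form_lin mulrA -expr2 mulrDr.
  by rewrite sqrtrM ?sqr_ge0 // sqrtr_sqr gtr0_norm.
have scaleA x v t : quad a (Tangent x (t *: v)) = t ^+ 2 * quad a (Tangent x v).
  by rewrite -[LHS]/(form (a x) _ _) !form_lin mulrA -expr2.
have nonempty x : fiber randers_domain x !=set0.
  have [v vv] := timelike_exists x.
  (* Either [v] or [-v] has B >= 0, and the root is positive at that one. *)
  have [nv|nv] := leP 0 (form (a x) (n x) v).
    exists v; split=> //=.
    by rewrite root_tangentE randers_root_gt0 ?nv.
  have vv' : 0 < form (a x) (- v) (- v) by rewrite !form_lin opprK.
  exists (- v); split=> //=; rewrite root_tangentE randers_root_gt0 //.
  by rewrite formNr oppr_ge0 ltW.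
split.
- split=> //.
  + by have [v Qv] := nonempty x0; exists (Tangent x0 v).
  + exact: randers_domain_open.
  + by move=> [x v] [/= vv _]; exact: (@form_neq0 _ (a x)).
  + move=> x v t t0 [/= vv sv]; split=> /=.
      by rewrite scaleA mulr_gt0 // exprn_gt0.
    by rewrite scale // mulr_gt0.
- by move=> p [/= /ltW].
- exact: randers_smooth.
- move=> x v t t0 _; rewrite /randers -!/(root_tangent _) scale //.
  by rewrite sgrM gtr0_sg // mul1r exprMn mulrCA.
- move=> [x v] [/= vv]; rewrite root_tangentE => sv.
  exact/lorentz_unitmx/vertical_hessian_lorentz.
Qed.

End RandersManifold.

(** * Timelike cones over the manifold and the equivalence *)

Section TimelikeCones.
Variables (R : realType) (M : manifold R).
Variables (a : M -> 'M[R]_4) (a_lorentzian : lorentzian_metric a).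
Variables (b : M -> 'rV[R]_4) (b_form : one_form b).
Implicit Types (x : M) (k v w : 'rV[R]_4) (C : set 'rV[R]_4).
Local Notation D := (randers_dom a).
Local Notation L := (randers a b).
Local Notation n := (covector_dual a b).

Let a_lorentz x : lorentz_signature (a x).
Proof. by case: a_lorentzian. Qed.

(** The open set [Q] lies in {A >= 0} and avoids 0; from a nonzero null vector a small step along
    some [w] with g(v,w) < 0 would reach A < 0. *)
Lemma pseudo_finsler_timelike Q x v : pseudo_finsler D L Q ->
  fiber Q x v -> 0 < form (a x) v v.
Proof.
move=> [[_ oQ Q0 _ _] QD _ _ _] Qv.
have : 0 <= form (a x) v v := QD _ Qv.
rewrite le_eqVlt => /predU1P[vv|//].
have [w vw] := form_lt0_exists (a_lorentz x) (Q0 _ Qv).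
pose f (t : R) := v + t *: w.
have cf : continuous f.
  move=> t; apply: cvgD; first exact: cvg_cst.
  by apply: cvgZr_tmp; exact: cvg_id.
have nQ : nbhs (f 0) (fiber Q x).
  rewrite /f scale0r addr0; apply: open_nbhs_nbhs.
  by split=> //; exact: fiber_open.
have := cf 0 _ nQ; rewrite nbhs_filterE fmapE => /nbhs_ballP[e /= e0 eQ].
set q := form (a x) w w; set r := form (a x) v w in vw.
(* The first bound keeps v + t w in [Q]; the second gives 2 r + t q < 0, so A < 0 there. *)
pose t := Num.min (e / 2) (- r / (`|q| + 1)).
have q0 : 0 < `|q| + 1 by rewrite ltr_wpDl.
have t0 : 0 < t by rewrite lt_min !divr_gt0 ?oppr_gt0.
have te : t < e by rewrite gt_min ltr_pdivrMr ?ltr0n // ltr_pMr // ltr1n.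
have tr : t * (`|q| + 1) <= - r by rewrite -ler_pdivlMr // ge_min lexx orbT.
have : 0 <= form (a x) (f t) (f t).
  apply: (QD (Tangent x (f t))); apply: eQ.
  by rewrite /ball /= sub0r normrN gtr0_norm.
rewrite /f !form_lin -vv (form_sym (a_lorentz x) w v) -/r -/q.
rewrite [X in 0 <= X](_ : _ = t * (2 * r + t * q)); last by ring.
rewrite pmulr_rge0 // leNgt => /negP[].
by have := ler_norm q; have := ltW t0; nra.
Qed.

(** This carries the results for one tangent space to the bundle. It yields the necessity of the
    norm condition, the description of the cones, and the sign of B on the future cone. *)
Lemma timelike_cone_analysis x k C : 0 < form (a x) k k ->
  timelike_cone_at D L x C -> C `&` cone (a x) k !=set0 ->
  C = randers_cone (a x) (n x) k /\
  0 <= dual_norm a b x /\ dual_norm a b x < 1 /\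
  (forall v, cone (a x) k v -> form (a x) (n x) v <= 0).
Proof.
move=> kk [_ oC _ [Q pQ CQ] [cC Cpos _ Cext]] Ck.
have Ctime v : C v -> 0 < form (a x) v v.
  by move=> /CQ; exact: pseudo_finsler_timelike.
have LE v : L (Tangent x v) = randers_form (a x) (n x) v.
  by rewrite -(randersE a_lorentzian).
have Cpos' v : C v -> 0 < randers_form (a x) (n x) v.
  by move=> Cv; rewrite -LE Cpos.
have Cext' : {within closure C, continuous (randers_form (a x) (n x) \_ C)}.
  by rewrite -(randersE a_lorentzian).
rewrite !dual_normE //; split.
  exact: (timelike_coneE (a_lorentz x) cC oC Ctime Cpos' Cext' kk Ck).
have [n0 n1] := timelike_cone_norm (a_lorentz x) cC oC Ctime Cpos' Cext' kk Ck.
split=> //; split=> //.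
exact: (timelike_cone_covector (a_lorentz x) cC oC Ctime Cpos' Cext' kk Ck).
Qed.

Lemma randers_cone_root x k v : randers_cone (a x) (n x) k v ->
  0 < form (a x) v v /\ 0 < randers_root (a x) (n x) v.
Proof. by move=> [[vv _] /= nv]; rewrite randers_root_gt0 // nv orbT. Qed.

Lemma timelike_fiber_randers_cone x k : 0 < form (a x) k k ->
  (forall v, cone (a x) k v -> form (a x) (n x) v <= 0) ->
  timelike_fiber L x (randers_cone (a x) (n x) k).
Proof.
move=> kk Kn; split.
- exact: randers_cone_connected.
- move=> v /randers_cone_root[vv sv].
  rewrite -[L _]/((fun v => L (Tangent x v)) v) randersE //.
  by rewrite randers_form_gt0.
- by move=> v /randers_cone_root[vv sv]; exact: vertical_hessian_lorentz.
- by rewrite randersE //; exact: randers_cone_extension.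
Qed.

Lemma randers_cone_scale x k v t : 0 < t ->
  randers_cone (a x) (n x) k v -> randers_cone (a x) (n x) k (t *: v).
Proof.
move=> t0 [[vv kv] /= nv]; split; first by split; rewrite !form_lin !mulr_gt0.
by rewrite /= !form_lin exprMn mulrA -expr2 ltr_pM2l // exprn_gt0.
Qed.

Lemma timelike_cone_randers x k : 0 < form (a x) k k ->
  (forall v, cone (a x) k v -> form (a x) (n x) v <= 0) ->
  0 <= dual_norm a b x -> dual_norm a b x < 1 ->
  timelike_cone_at D L x (randers_cone (a x) (n x) k).
Proof.
rewrite dual_normE // => kk Kn n0 n1; split.
- have [v Kv nv] := randers_cone_nonempty (a_lorentz x) kk n0 n1 Kn.
  by exists v.
- exact: randers_cone_open.
- by move=> v t; exact: randers_cone_scale.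
- exists (randers_domain a b).
    by apply: pseudo_finsler_randers => //; exists x.
  move=> v /randers_cone_root[vv sv]; split=> //=.
  by rewrite root_tangentE.
- exact: timelike_fiber_randers_cone.
Qed.

Lemma timelike_cone_fiber (T : set (tangent M)) x : finsler_cones D L T ->
  timelike_cone_at D L x (fiber T x).
Proof.
move=> [[_ oT _ T0 Tscale] _ [Q pQ TQ] Tx]; split=> //.
- exact: fiber_open.
- by move=> v t t0; exact: Tscale.
- by exists Q => // v /TQ.
Qed.

Variables (Ta : set (tangent M)) (Ta_future : time_orientation a Ta).

Lemma time_orientation_cone x : exists2 k, 0 < form (a x) k k &
  fiber Ta x = cone (a x) k.
Proof.
have [_ /(_ x)[k kk ->]] := Ta_future; exists k => //.
exact: (cone_component (a_lorentz x) kk).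
Qed.

Hypothesis cones_Ta : cones_meet D L Ta.

(** By [covector_sign], B <= 0 on the cone of [k] or of [-k], so L has a timelike cone at [x]. The
    standing assumption then provides one meeting the future cone, where the analysis gives the
    sign. *)
Lemma future_covector x : 0 <= dual_norm a b x -> dual_norm a b x < 1 ->
  forall v, fiber Ta x v -> form (a x) (n x) v <= 0.
Proof.
move=> n0 n1; have [k kk TaE] := time_orientation_cone x.
have [C CC] : exists C, timelike_cone_at D L x C.
  have := covector_sign (a_lorentz x) kk (_ : 0 <= form (a x) (n x) (n x)).
  rewrite -dual_normE // => /(_ n0)[Kn|Kn].
    by exists (randers_cone (a x) (n x) k); exact: timelike_cone_randers.
  have kk' : 0 < form (a x) (- k) (- k) by rewrite !form_lin opprK.
  exists (randers_cone (a x) (n x) (- k)); apply: timelike_cone_randers => //.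
  move=> v [vv]; rewrite formNl -formNr => kv.
  rewrite -oppr_ge0 -formNr; apply: Kn; split=> //.
  by rewrite !form_lin opprK.
have [C' CC' meets] := cones_Ta (ex_intro _ C CC).
rewrite TaE in meets *.
by have [_ [_ [_ Kn]]] := timelike_cone_analysis kk CC' meets.
Qed.

Definition randers_cones : set (tangent M) :=
  [set p | 0 < quad a p - pairing b p ^+ 2] `&` Ta.

Lemma fiber_randers_cones x k : fiber Ta x = cone (a x) k ->
  fiber randers_cones x = randers_cone (a x) (n x) k.
Proof.
move=> TaE; rewrite /randers_cone -TaE; apply/seteqP.
split=> v [] => [/= + Tv|Tv /= nv].
  by rewrite (pairingE a_lorentzian) subr_gt0; split.
by split=> //=; rewrite (pairingE a_lorentzian) subr_gt0.
Qed.

(** The fiberwise conditions come from the pointwise results; openness comes from the global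
    formula, and connectedness from that of [M] and of the fibers. *)
Lemma finsler_cones_randers : [set: M] !=set0 -> connected [set: M] ->
  (forall x, 0 <= dual_norm a b x /\ dual_norm a b x < 1) ->
  finsler_cones D L randers_cones.
Proof.
move=> M0 cM norm.
have fibers x : exists2 k, 0 < form (a x) k k &
    fiber randers_cones x = randers_cone (a x) (n x) k /\
    (forall v, cone (a x) k v -> form (a x) (n x) v <= 0).
  have [k kk TaE] := time_orientation_cone x; exists k => //.
  split; first exact: fiber_randers_cones.
  by rewrite -TaE; have [n0 n1] := norm x; exact: future_covector.
have cones x : timelike_cone_at D L x (fiber randers_cones x).
  have [k kk [-> Kn]] := fibers x; have [n0 n1] := norm x.
  exact: timelike_cone_randers.
have oT : open randers_cones.
  by apply: openI; [exact: open_randers_cones | case: Ta_future].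
have T0 x : fiber randers_cones x !=set0 by case: (cones x).
split.
- split=> //.
  + by have [x _] := M0; have [v Tv] := T0 x; exists (Tangent x v).
  + move=> [x v] Tv; have [k kk [TE _]] := fibers x.
    have : fiber randers_cones x v by [].
    by rewrite TE => /randers_cone_root[/form_neq0].
  + by move=> x v t t0 Tv; have [_ _ /(_ v t t0 Tv)] := cones x.
- by apply: connected_tangent => // x; have [_ _ _ _ []] := cones x.
- exists (randers_domain a b); first exact: pseudo_finsler_randers.
  move=> [x v] Tv; have [k kk [TE _]] := fibers x.
  have : fiber randers_cones x v by [].
  rewrite TE => /randers_cone_root[vv sv]; split=> //=.
  by rewrite root_tangentE.
- by move=> x; have [] := cones x.
Qed.

End TimelikeCones.

Theorem proposition7 (R : realType) (M : manifold R)
    (M_nonempty : [set: M] !=set0) (M_connected : connected [set: M])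
    (M_orientable : orientable M)
    (a : M -> 'M[R]_4) (a_lorentzian : lorentzian_metric a)
    (b : M -> 'rV[R]_4) (b_form : one_form b)
    (Ta : set (tangent M)) (Ta_future : time_orientation a Ta)
    (cones_Ta : cones_meet (randers_dom a) (randers a b) Ta) :
  (finsler_spacetime (randers_dom a) (randers a b) <->
     (forall x : M, 0 <= dual_norm a b x /\ dual_norm a b x < 1)) /\
  (forall T : set (tangent M),
     finsler_cones (randers_dom a) (randers a b) T ->
     (forall x : M, fiber T x `&` fiber Ta x !=set0) ->
     forall x : M, fiber T x =
       [set v | 0 < quad a (Tangent x v) - pairing b (Tangent x v) ^+ 2]
         `&` fiber Ta x).
Proof.
split; last first.
  move=> T finT meets x.
  have [k kk TaE] := time_orientation_cone a_lorentzian Ta_future x.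
  have := meets x; rewrite TaE => Tk.
  have [-> _] :=
    timelike_cone_analysis a_lorentzian kk (timelike_cone_fiber x finT) Tk.
  by rewrite -(fiber_randers_cones a_lorentzian b TaE) -TaE.
split=> [[T finT] x|norm].
  (* The fiber of [T] may miss the future cone of [a]; it shows that a timelike cone exists, and the
     cone supplied by [cones_Ta] is the one analyzed. *)
  have [|C CC] := cones_Ta x.
    by exists (fiber T x); exact: timelike_cone_fiber.
  have [k kk ->] := time_orientation_cone a_lorentzian Ta_future x => Ck.
  by have [_ [? [? _]]] := timelike_cone_analysis a_lorentzian kk CC Ck.
exists (randers_cones a b Ta).
exact: finsler_cones_randers.
Qed.
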